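(* Let $P$ be an $n$-dimensional Gorenstein lattice polytope in $\mathbb{R}^n$ of degree $d$. Then $P$ decomposes as a Cayley sum of lattice polytopes in $\mathbb{R}^q$ for some $q\le 2d-1$.
   Context: For an $n$-dimensional lattice polytope $P\subset\mathbb{R}^n$, write $\sum_{m\ge0}|mP\cap\mathbb{Z}^n|t^m = h^*_P(t)/(1-t)^{n+1}$ with $h^*_P(t)=h^*_0+\dots+h^*_dt^d$ a polynomial of degree $d$, the degree of $P$. $P$ is Gorenstein if $h^*_i=h^*_{d-i}$ for $0\le i\le d$. If $P_0,\dots,P_s$ are lattice polytopes in $\mathbb{R}^q$, their Cayley sum $P_0*\cdots*P_s$ is the convex hull of $(P_0\times 0)\cup(P_1\times e_1)\cup\cdots\cup(P_s\times e_s)$ in $\mathbb{R}^q\times\mathbb{R}^s$ ($e_i$ the standard basis). $P$ decomposes as a Cayley sum of lattice polytopes in $\mathbb{R}^q$ if some affine isomorphism $\mathbb{R}^n\cong\mathbb{R}^q\times\mathbb{R}^s$ mapping $\mathbb{Z}^n$ onto $\mathbb{Z}^{q}\times\mathbb{Z}^s$ identifies $P$ with $P_0*\cdots*P_s$ for some lattice polytopes $P_0,\dots,P_s\subset\mathbb{R}^q$.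
   Formalization: For degree d = 0 (unimodular simplices) the bound q ≤ 2d−1 = −1 is impossible, so the claim fails as written; the formal statement reads the bound as q ≤ max(2d−1, 0), i.e. q = 0 when d = 0, and is unchanged for d ≥ 1. *)

(* Defs.v *)
From HB Require Import structures.
From mathcomp Require Import all_boot all_order all_algebra.
Set Implicit Arguments. Unset Strict Implicit. Unset Printing Implicit Defensive.
Import Order.TTheory GRing.Theory Num.Theory.
Local Open Scope ring_scope.

Section Defs.
Variable R : realFieldType.

Definition intvec {k} (z : 'rV[int]_k) : 'rV[R]_k := map_mx (fun a : int => a%:~R) z.

Definition is_lattice {k} (x : 'rV[R]_k) : Prop := exists z : 'rV[int]_k, x = intvec z.

Definition in_hull {k} (S : 'rV[R]_k -> Prop) (y : 'rV[R]_k) : Prop :=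
  exists (m : nat) (p : 'I_m -> 'rV[R]_k) (w : 'I_m -> R),
    [/\ forall i, S (p i), forall i, 0 <= w i, \sum_i w i = 1
      & y = \sum_i w i *: p i].

Definition conv_lat {k} (V : seq 'rV[int]_k) : 'rV[R]_k -> Prop :=
  in_hull (fun x => exists2 v, v \in V & x = intvec v).

Definition lattice_polytope {k} (P : 'rV[R]_k -> Prop) : Prop :=
  exists V : seq 'rV[int]_k, V != [::] /\ forall x, P x <-> conv_lat V x.

Definition full_dim {n} (P : 'rV[R]_n -> Prop) : Prop :=
  exists p : 'I_n.+1 -> 'rV[R]_n, (forall i, P (p i)) /\
    \rank (\matrix_(i < n) (p (lift ord0 i) - p ord0)) = n.

Definition lattice_count {n} (P : 'rV[R]_n -> Prop) (m : nat) (c : nat) : Prop :=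
  exists s : seq 'rV[int]_n, [/\ uniq s, size s = c &
    forall z, z \in s <-> exists2 x, P x & intvec z = m%:R *: x].

(* h is the h*-polynomial of the n-dimensional polytope P:
   sum_m |mP ∩ Z^n| t^m = h(t)/(1-t)^(n+1), i.e. coefficientwise
   |mP ∩ Z^n| = sum_{i <= m} h_i * binom(m - i + n, n). *)
Definition is_hstar {n} (P : 'rV[R]_n -> Prop) (h : {poly int}) : Prop :=
  forall m : nat, exists c : nat, lattice_count P m c /\
    (c%:Z = \sum_(i < size h | (i <= m)%N) h`_i * ('C(m - i + n, n))%:Z).

Definition hdeg (h : {poly int}) : nat := (size h).-1.

Definition gorenstein_hstar (h : {poly int}) : Prop :=
  forall i : nat, (i <= hdeg h)%N -> h`_i = h`_(hdeg h - i).

(* Cayley sum P0 * P1 * ... * Ps in R^q x R^s = R^(q+s), with e_j the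
   standard basis of R^s (P_(j+1) is Ps j, j : 'I_s). *)
Definition cayley_sum {q s} (P0 : 'rV[R]_q -> Prop) (Ps : 'I_s -> 'rV[R]_q -> Prop)
  : 'rV[R]_(q + s) -> Prop :=
  in_hull (fun z => (exists2 x, P0 x & z = row_mx x 0)
                 \/ (exists j, exists2 x, Ps j x & z = row_mx x (delta_mx 0 j))).

Definition cayley_decomposes {n} (P : 'rV[R]_n -> Prop) (q : nat) : Prop :=
  exists (s : nat) (A : 'M[R]_(n, q + s)) (A' : 'M[R]_(q + s, n)) (b : 'rV[R]_(q + s))
         (P0 : 'rV[R]_q -> Prop) (Ps : 'I_s -> 'rV[R]_q -> Prop),
    let f := fun x : 'rV[R]_n => x *m A + b in
    [/\ A *m A' = 1%:M /\ A' *m A = 1%:M,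
        (forall x, is_lattice x -> is_lattice (f x)),
        (forall y, is_lattice y -> exists2 x, is_lattice x & f x = y),
        lattice_polytope P0 /\ (forall j, lattice_polytope (Ps j))
      & forall y, (exists2 x, P x & f x = y) <-> cayley_sum P0 Ps y].

End Defs.

(* Main.v *)
(** Let [C] be the cone over [P x {1}] in dimension [N = n + 1]. A regular
    triangulation of [C] into simplicial cones spanned by vertices, made
    half-open with respect to a generic interior vector [xi], partitions the
    lattice points of [C]; the same cones opened with respect to [- xi]
    partition those of its interior. The complementation
    [b |-> sum_i a_i - b] of the fundamental parallelepipeds gives Ehrhart
    reciprocity. If [h*] is symmetric of degree [d], the counts then force
    [int C] and [x + C] to have the same lattice points for a lattice point
    [x] of height [r = N - d], and hence every facet functional [w] normalised
    by [w x = 1] is integral.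

    By Caratheodory's theorem for the dual cone, the height functional is
    [e = sum_i l_i w_i] with [l_i >= 0] and independent facet functionals
    [w_i]. Its fractional part [g] satisfies [g x <= d], so [e] is a sum of at
    least [n + 2 - 2d] nonzero integral functionals nonnegative on [P]. These
    functionals take values 0 and 1 at the vertices, exactly one of them being
    1, and they complete to a unimodular change of coordinates exhibiting [P]
    as a Cayley sum. *)
Require Import Defs.
From HB Require Import structures.
From mathcomp Require Import all_boot all_order all_algebra.
From mathcomp Require Import zify ring lra.
Import Order.TTheory GRing.Theory Num.Theory.
Local Open Scope ring_scope.
Set Implicit Arguments. Unset Strict Implicit. Unset Printing Implicit Defensive.

(** * Simplicial cones and Caratheodory's theorem *)

Definition nneg {F : numDomainType} {k} (l : 'rV[F]_k) := forall i, 0 <= l 0 i.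

Section Simplicial.
Variables (F : realFieldType) (K N : nat) (A : 'M[F]_(K, N)).
Implicit Types (s t : {ffun 'I_N -> 'I_K}) (y : 'rV[F]_N).

Definition cone y := exists2 l : 'rV[F]_K, nneg l & y = l *m A.

Definition basis s : bool := rowsub s A \in unitmx.

Definition coord s y : 'rV[F]_N := y *m invmx (rowsub s A).

Lemma coordK s y : basis s -> coord s y *m rowsub s A = y.
Proof. by move=> bs; rewrite mulmxKV. Qed.

Lemma coord_comb s (l : 'rV_N) : basis s -> coord s (l *m rowsub s A) = l.
Proof. by move=> bs; rewrite /coord mulmxK. Qed.

Lemma coordD s x y : coord s (x + y) = coord s x + coord s y.
Proof. exact: mulmxDl. Qed.

Lemma coordZ s a y : coord s (a *: y) = a *: coord s y.
Proof. by rewrite /coord scalemxAl. Qed.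

Lemma coordB s x y : coord s (x - y) = coord s x - coord s y.
Proof. exact: mulmxBl. Qed.

Lemma coordDE s x y i : coord s (x + y) 0 i = coord s x 0 i + coord s y 0 i.
Proof. by rewrite coordD [LHS]mxE. Qed.

Lemma coordBE s x y i : coord s (x - y) 0 i = coord s x 0 i - coord s y 0 i.
Proof. by rewrite coordB [LHS]mxE; congr (_ + _); rewrite [LHS]mxE. Qed.

Lemma coordZE s a y i : coord s (a *: y) 0 i = a * coord s y 0 i.
Proof. by rewrite coordZ [LHS]mxE. Qed.

Lemma coord_row s i : basis s -> coord s (row (s i) A) = delta_mx 0 i.
Proof.
move=> bs; have -> : row (s i) A = delta_mx 0 i *m rowsub s A.
  by rewrite -rowE; apply/rowP=> j; rewrite !mxE.
exact: coord_comb.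
Qed.

Lemma comb_in_cone s (l : 'rV_N) : nneg l -> cone (l *m rowsub s A).
Proof.
move=> l0; exists (\row_j \sum_(i | s i == j) l 0 i).
  by move=> j; rewrite mxE sumr_ge0.
rewrite !mulmx_sum_row (partition_big s predT) //=; apply: eq_bigr => j _.
rewrite mxE scaler_suml; apply: eq_bigr => i /eqP <-; congr (_ *: _).
by apply/rowP=> k; rewrite !mxE.
Qed.

Lemma coord_cone s y : basis s -> nneg (coord s y) -> cone y.
Proof. by move=> bs /(comb_in_cone s); rewrite coordK. Qed.

Lemma coneD x y : cone x -> cone y -> cone (x + y).
Proof.
move=> [l l0 ->] [m m0 ->]; exists (l + m); last by rewrite mulmxDl.
by move=> i; rewrite mxE addr_ge0.
Qed.

Lemma coneZ a y : 0 <= a -> cone y -> cone (a *: y).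
Proof.
move=> a0 [l l0 ->]; exists (a *: l); last by rewrite scalemxAl.
by move=> i; rewrite mxE mulr_ge0.
Qed.

Lemma cone0 : cone 0.
Proof. by exists 0; [move=> i; rewrite mxE | rewrite mul0mx]. Qed.

Lemma cone_row j : cone (row j A).
Proof.
by exists (delta_mx 0 j); [move=> i; rewrite mxE ler0n | rewrite -rowE].
Qed.

Lemma cone_ind (Q : 'rV_N -> Prop) :
  Q 0 -> (forall y a j, Q y -> 0 <= a -> Q (y + a *: row j A)) ->
  forall y, cone y -> Q y.
Proof.
move=> Q0 QD y [l l0 ->]; rewrite mulmx_sum_row.
by elim/big_rec: _ => // j x _ Qx; rewrite addrC; apply: QD.
Qed.

Definition pivot s i j : {ffun 'I_N -> 'I_K} :=
  [ffun k => if k == i then j else s k].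

Lemma comb_pivot s i j (l : 'rV_N) b : l 0 i = 0 ->
  (\row_k (if k == i then b else l 0 k)) *m rowsub (pivot s i j) A
  = l *m rowsub s A + b *: row j A.
Proof.
move=> li0; rewrite !mulmx_sum_row (bigD1 i) //= [in RHS](bigD1 i) //=.
rewrite li0 scale0r add0r addrC; congr (_ + _).
  apply: eq_bigr => k ki; rewrite mxE (negPf ki); congr (_ *: _).
  by apply/rowP => z; rewrite !mxE ffunE (negPf ki).
rewrite mxE eqxx; congr (_ *: _).
by apply/rowP => z; rewrite !mxE ffunE eqxx.
Qed.

(** Exchange argument: the coefficient of the generator [s i] in [row j A] is nonzero, so solving
    for that generator shows that the new rows still span the old ones. *)
Lemma basis_pivot s i j :
  basis s -> coord s (row j A) 0 i != 0 -> basis (pivot s i j).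
Proof.
move=> bs; have := coordK (row j A) bs; move: (coord _ _) => c ec ci.
rewrite /basis -row_full_unit -sub1mx.
have full : (1%:M <= rowsub s A)%MS by rewrite sub1mx row_full_unit.
apply: submx_trans full _; apply/row_subP => k.
have [-> | ki] := eqVneq k i; last first.
  have -> : row k (rowsub s A) = row k (rowsub (pivot s i j) A).
    by apply/rowP => z; rewrite !mxE ffunE (negPf ki).
  exact: row_sub.
pose l : 'rV[F]_N := \row_z (if z == i then 0 else - (c 0 i)^-1 * c 0 z).
have li : l 0 i = 0 by rewrite mxE eqxx.
have := comb_pivot s j (c 0 i)^-1 li.
suff -> : l *m rowsub s A + (c 0 i)^-1 *: row j A = row i (rowsub s A).
  by move=> <-; apply: submxMl.
rewrite -ec scalemxAl -mulmxDl [RHS]rowE.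
congr (_ *m _); apply/rowP => z; rewrite !mxE eqxx /=.
by case: eqVneq => [->|zi]; rewrite ?mulVf ?add0r // mulNr addNr.
Qed.

Lemma coord_pivot s i j (l : 'rV_N) b : basis (pivot s i j) -> l 0 i = 0 ->
  coord (pivot s i j) (l *m rowsub s A + b *: row j A)
  = \row_k (if k == i then b else l 0 k).
Proof. by move=> bp li; rewrite -(comb_pivot _ _ _ li) coord_comb. Qed.

(** Minimal ratio rule of the simplex method. Where [c] is not positive, subtracting a nonnegative
    multiple of it cannot break the sign. *)
Lemma ratio_test (l c : 'rV[F]_N) : nneg l -> (exists i, 0 < c 0 i) ->
  exists2 i, 0 < c 0 i & forall k, 0 <= l 0 k - l 0 i / c 0 i * c 0 k.
Proof.
move=> l0 [i0 ci0].
have [i ci mini] := @Order.TotalTheory.arg_minP _ _ _ i0 (fun i => 0 < c 0 i)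
   (fun i => l 0 i / c 0 i) ci0.
exists i => // k; rewrite subr_ge0.
have [ck|ck] := ltP 0 (c 0 k); first by rewrite -ler_pdivlMr // mini.
by apply: le_trans (l0 k); rewrite mulr_ge0_le0 // divr_ge0 // ltW.
Qed.

(** Generators are added one at a time. If adding [T *: row j A] makes a coordinate negative, the
    basis is exchanged at the moment when the first coordinate reaches zero. *)
Lemma caratheodory y : row_full A -> cone y ->
  exists2 s, basis s & nneg (coord s y).
Proof.
move=> fA; move: y.
apply: (@cone_ind (fun y => exists2 s, basis s & nneg (coord s y))).
  exists [ffun i => fullrankfun fA i]; last first.
    by move=> i; rewrite /coord mul0mx mxE.
  rewrite /basis (_ : rowsub _ A = rowsub (fullrankfun fA) A).
    exact: fullrowsub_unit.
  by apply: eq_rowsub => i; rewrite ffunE.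
move=> y T j [s bs ly] T0.
have [c cE] : exists c, coord s (row j A) = c by eexists.
have [l lE] : exists l, coord s y = l by eexists.
have ey := coordK y bs; have ec := coordK (row j A) bs.
have ely z : coord s (y + T *: row j A) 0 z = l 0 z + T * c 0 z.
  by rewrite coordDE coordZE lE cE.
rewrite {}lE in ly ey; rewrite cE in ec.
have [/forallP pos|/forallPn[k]] := boolP [forall k, 0 <= l 0 k + T * c 0 k].
  by exists s => // i; rewrite ely; apply: pos.
rewrite -ltNge => neg.
have ck : c 0 k < 0.
  by rewrite ltNge; apply/negP => ck; have := ly k; nra.
have [|i ci Hi] := @ratio_test l (- c) ly.
  by exists k; rewrite mxE oppr_gt0.
move: ci; rewrite mxE oppr_gt0 => ci.
have {}Hi z : 0 <= l 0 z + - (l 0 i / c 0 i) * c 0 z.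
  by have := Hi z; rewrite !mxE invrN mulrN; congr (_ <= _); ring.
(* The largest step along [row j A] that keeps all coordinates nonnegative; there coordinate [i]
   vanishes, and the rest [T - b] becomes the coefficient of the new generator [j]. *)
set b := - (l 0 i / c 0 i) in Hi.
have b0 : 0 <= b by rewrite oppr_ge0 mulr_ge0_le0 // invr_le0 ltW.
have bT : b <= T by rewrite leNgt; apply/negP => h; have := Hi k; nra.
have bp : basis (pivot s i j) by apply: basis_pivot => //; rewrite cE lt_eqF.
exists (pivot s i j) => // z.
have li : (l + b *: c) 0 i = 0.
  by rewrite !mxE /b mulNr divfK ?subrr // lt_eqF.
have -> : y + T *: row j A = (l + b *: c) *m rowsub s A + (T - b) *: row j A.
  by rewrite mulmxDl -scalemxAl ey ec -addrA -scalerDl [b + _]addrC subrK.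
rewrite coord_pivot // !mxE; case: eqP => _; first by rewrite subr_ge0.
exact: Hi.
Qed.

End Simplicial.

(** * Regular triangulations *)

(** The point is taken on the moment curve [(1, x, x ^+ 2, ...)]. Each hyperplane becomes a nonzero
    polynomial in [x], and their product [p] cannot vanish at all of [1, ..., size p]. *)
Lemma avoid_hyperplanes (F : realFieldType) (I : finType) K (g : I -> 'rV[F]_K) :
  (forall i, g i != 0) ->
  exists2 t : 'rV[F]_K, forall j, 0 < t 0 j
    & forall i, \sum_j g i 0 j * t 0 j != 0.
Proof.
move=> g0; pose p := \prod_i rVpoly (g i).
have p0 : p != 0.
  apply/prodf_neq0 => i _; apply: contra_neq (g0 i) => h.
  by rewrite -[LHS]rVpolyK h linear0.
have /allPn[x xs rx] :
    ~~ all (root p) [seq m.+1%:R | m <- iota 0 (size p)].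
  apply/negP => /(max_poly_roots p0).
  rewrite size_map size_iota ltnn map_inj_uniq ?iota_uniq; first by move=> /(_ isT).
  by move=> a b /eqP; rewrite eqr_nat => /eqP [].
have x0 : 0 < x by have /mapP[m _ ->] := xs; rewrite ltr0Sn.
exists (\row_j x ^+ j) => [j|i]; first by rewrite mxE exprn_gt0.
have : (rVpoly (g i)).[x] != 0.
  move: rx; rewrite /root horner_prod => /prodf_neq0; exact.
rewrite horner_poly; congr (_ != _); apply: eq_bigr => j _.
by rewrite valK mxE.
Qed.

Section Triangulation.
Variables (F : realFieldType) (K N : nat) (A : 'M[F]_(K, N)) (om : 'rV[F]_K).
Implicit Types (s t : {ffun 'I_N -> 'I_K}) (y : 'rV[F]_N).

(** The linear function interpolating the lifting heights [om] at the generators of the simplicial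
    cone [s]. *)
Definition lift_val s y := \sum_k coord A s y 0 k * om 0 (s k).

Lemma lift_val_comb s m (l : 'rV_m) (B : 'M_(m, N)) :
  lift_val s (l *m B) = \sum_j l 0 j * lift_val s (row j B).
Proof.
rewrite /lift_val; under [RHS]eq_bigr do rewrite mulr_sumr.
rewrite exchange_big /=; apply: eq_bigr => k _.
under [RHS]eq_bigr do rewrite mulrA.
rewrite -mulr_suml; congr (_ * _).
rewrite /coord -mulmxA [LHS]mxE; apply: eq_bigr => j _.
by rewrite -row_mul [in RHS]mxE.
Qed.

Lemma lift_val_row s i : basis A s -> lift_val s (row (s i) A) = om 0 (s i).
Proof.
move=> bs; rewrite /lift_val coord_row // (bigD1 i) //= mxE !eqxx mul1r.
by rewrite big1 ?addr0 // => k ki; rewrite mxE (negPf ki) andbF mul0r.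
Qed.

(** Lower facets of the lifted generators, that is, the maximal cones of the regular triangulation
    induced by [om]; strictness excludes further generators on the facet. *)
Definition lower s := basis A s &&
  [forall j, (j \notin codom s) ==> (lift_val s (row j A) < om 0 j)].

Lemma lower_le s j : lower s -> lift_val s (row j A) <= om 0 j.
Proof.
move=> /andP[bs /forallP/(_ j)/implyP h].
have [/codomP[i ->]|/h/ltW //] := boolP (j \in codom s).
by rewrite lift_val_row.
Qed.

Lemma lift_val_basis s t y : basis A t ->
  lift_val s y = \sum_k coord A t y 0 k * lift_val s (row (t k) A).
Proof.
move=> bt; rewrite -[in LHS](coordK y bt) lift_val_comb; apply: eq_bigr => k _.
by congr (_ * lift_val _ _); apply/rowP => z; rewrite !mxE.
Qed.

Lemma lift_val_le s t y : lower s -> basis A t -> nneg (coord A t y) ->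
  lift_val s y <= lift_val t y.
Proof.
move=> ls bt ty; rewrite (lift_val_basis s y bt) ler_sum // => k _.
by rewrite ler_wpM2l // lower_le.
Qed.

(** By [lift_val_le] in both directions the two interpolations agree at [y]. Expanding [y] in [t],
    the nonnegative gaps have positive weights and sum to zero, so each generator of [t] lies on the
    facet of [s]. *)
Lemma lower_codom s t y : lower s -> lower t -> nneg (coord A s y) ->
  (forall i, 0 < coord A t y 0 i) -> {subset codom t <= codom s}.
Proof.
move=> ls lt sy ty; have [/andP[bs /forallP hs] /andP[bt _]] := (ls, lt).
have e : lift_val t y = lift_val s y.
  by apply/le_anti; rewrite !lift_val_le // => i; apply: ltW.
have : \sum_k coord A t y 0 k * (om 0 (t k) - lift_val s (row (t k) A)) = 0.
  under eq_bigr do rewrite mulrBr.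
  by rewrite sumrB -(lift_val_basis s y bt) -e subrr.
move=> /psumr_eq0P h x /codomP[i ->].
have /eqP : coord A t y 0 i * (om 0 (t i) - lift_val s (row (t i) A)) = 0.
  by apply: h => // k _; rewrite mulr_ge0 ?subr_ge0 ?lower_le // ltW.
rewrite mulf_eq0 gt_eqF //= subr_eq0 => /eqP et.
by have /implyP := hs (t i); case: (_ \in _) => //; rewrite et ltxx => /(_ isT).
Qed.

Definition generic y := forall s i, basis A s -> coord A s y 0 i != 0.

Variable e : 'cV[F]_N.
Hypothesis height1 : A *m e = const_mx 1.
Hypothesis om_generic : forall s j, basis A s -> j \notin codom s ->
  lift_val s (row j A) != om 0 j.

(* A basis minimising the lifted value at [y] is a lower facet: otherwise a
   simplex pivot would decrease the value further. *)
Lemma lower_exists y : row_full A -> cone A y -> generic y ->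
  exists2 s, lower s & forall i, 0 < coord A s y 0 i.
Proof.
move=> fA Cy gy; have [s0 bs0 ys0] := caratheodory fA Cy.
pose good s := basis A s && [forall i, 0 <= coord A s y 0 i].
have gs0 : good s0 by rewrite /good bs0; apply/forallP.
have [s /andP[bs /forallP ys] mins] :=
  @Order.TotalTheory.arg_minP _ _ _ s0 good (fun s => lift_val s y) gs0.
have {}ys i : 0 < coord A s y 0 i by rewrite lt_def gy // ys.
exists s => //; rewrite /lower bs; apply/forallP => j; apply/implyP => js.
rewrite lt_neqAle om_generic // leNgt; apply/negP => neg.
have [c cE] : exists c, coord A s (row j A) = c by eexists.
have [l lE] : exists l, coord A s y = l by eexists.
have ec := coordK (row j A) bs; have ey := coordK y bs.
have vc : lift_val s (row j A) = \sum_k c 0 k * om 0 (s k) by rewrite -cE.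
have vy : lift_val s y = \sum_k l 0 k * om 0 (s k) by rewrite -lE.
rewrite {}cE in ec; rewrite {}lE in ey ys.
(* All generators have height 1, so the coordinates of a generator sum to 1; one of them is
   positive, as the ratio test requires. *)
have sumc : \sum_k c 0 k = 1.
  have : (row j A *m e) 0 0 = 1 by rewrite -row_mul height1 !mxE.
  rewrite -ec -mulmxA [X in X = _]mxE => <-; apply: eq_bigr => k _.
  rewrite (_ : rowsub s A *m e = const_mx 1) ?mxE ?mulr1 //.
  by rewrite mul_rowsub_mx height1; apply/matrixP => ? ?; rewrite !mxE.
have [|i ci Hi] := @ratio_test _ _ l c (fun i => ltW (ys i)).
  apply/existsP; apply: contraT => /existsPn h.
  suff : \sum_k c 0 k <= 0 by rewrite sumc ler10.
  by apply: sumr_le0 => k _; rewrite leNgt.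
have ciE : coord A s (row j A) 0 i = c 0 i by rewrite -[in LHS]ec coord_comb.
have bp : basis A (pivot s i j) by apply: basis_pivot => //; rewrite ciE gt_eqF.
set b := l 0 i / c 0 i in Hi.
have b0 : 0 < b by rewrite divr_gt0.
have li : (l - b *: c) 0 i = 0 by rewrite !mxE /b divfK ?subrr // gt_eqF.
have yE : y = (l - b *: c) *m rowsub s A + b *: row j A.
  by rewrite mulmxBl -scalemxAl ec ey subrK.
have cpE := coord_pivot b bp li; rewrite -yE in cpE.
have gp : good (pivot s i j).
  rewrite /good bp; apply/forallP => k; rewrite cpE mxE.
  by case: ifP => _; rewrite ?(ltW b0) // !mxE.
have := mins _ gp; rewrite leNgt => /negP; apply.
rewrite vy /lift_val cpE (bigD1 i) //= mxE eqxx ffunE eqxx.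
have -> : \sum_(k | k != i) (\row_k0 (if k0 == i then b else (l - b *: c) 0 k0)) 0 k
    * om 0 (pivot s i j k) = \sum_k l 0 k * om 0 (s k) - b * lift_val s (row j A).
  rewrite vc mulr_sumr -sumrB [RHS](bigD1 i) //= mulrA -mulrBl.
  have -> : l 0 i - b * c 0 i = 0 by rewrite -li !mxE.
  rewrite mul0r add0r; apply: eq_bigr => k ki.
  by rewrite !mxE ffunE (negPf ki) mulrBl mulrA.
by rewrite addrCA gtrDl -mulrBr pmulr_rlt0 // subr_lt0.
Qed.

End Triangulation.

(** * Half-open decompositions *)

Lemma small_perturbation (F : realFieldType) (I : finType) (a b : I -> F) :
  (forall i, b i != 0) ->
  exists2 d, 0 < d & forall d', 0 < d' <= d -> forall i,
    a i + d' * b i != 0 /\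
    (0 < a i + d' * b i) = (0 < a i) || (a i == 0) && (0 < b i).
Proof.
(* Indices with [a i = 0] contribute 0 to [S], the inverse of 0 being 0; for the others the bound
   below makes [d * b i] smaller than [a i] in absolute value. *)
move=> b0; pose S := \sum_i `|b i| / `|a i|.
have S0 : 0 <= S by apply: sumr_ge0 => i _; rewrite divr_ge0.
have S1 : 0 < 1 + S by rewrite ltr_wpDr.
exists (1 + S)^-1; first by rewrite invr_gt0.
move=> d /andP[d0 dS] i.
have [->|ai] := eqVneq (a i) 0.
  rewrite add0r ltxx pmulr_rgt0 //; split=> //.
  by apply: mulf_neq0 => //; rewrite gt_eqF.
rewrite orbF; have na : 0 < `|a i| by rewrite normr_gt0.
have : `|d * b i| < `|a i|.
  rewrite normrM (gtr0_norm d0) -[X in _ < X]mul1r -ltr_pdivrMr //.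
  have Si : `|b i| / `|a i| <= S.
    by rewrite /S (bigD1 i) //= lerDl sumr_ge0 // => k _; rewrite divr_ge0.
  rewrite -mulrA; apply: le_lt_trans (ler_pM (ltW d0) _ dS Si) _.
    by rewrite divr_ge0.
  by rewrite mulrC ltr_pdivrMr // mul1r ltrDr.
move: (d * b i) => x; rewrite ltr_norml => /andP[].
have [a_gt|a_lt|/eqP] := ltrgt0P (a i); last by rewrite (negPf ai).
  move=> h1 h2; have pos : 0 < a i + x by lra.
  by rewrite pos gt_eqF.
move=> h1 h2; have neg : a i + x < 0 by lra.
by rewrite lt_eqF // lt_gtF // lt_gtF.
Qed.

Section HalfOpen.
Variables (F : realFieldType) (K N : nat) (A : 'M[F]_(K, N)).
Implicit Types (s t : {ffun 'I_N -> 'I_K}) (y xi : 'rV[F]_N) (eps : bool).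

(** The direction is [xi] for [eps = false] and [- xi] for [eps = true]. For generic [xi], a facet
    is kept exactly when the direction points to its inner side. *)
Definition closed_at xi eps s i : bool := (0 < coord A s xi 0 i) (+) eps.

Definition half_open xi eps s y : bool := [forall i,
  if closed_at xi eps s i then 0 <= coord A s y 0 i else 0 < coord A s y 0 i].

(** A half-open cone contains [y] exactly when its open cone contains [y] moved slightly in the
    chosen direction. Finitely many coordinates are involved, so one bound on the step serves all
    bases. *)
Lemma half_open_perturb xi eps y : generic A xi ->
  exists2 d, 0 < d & forall d', 0 < d' <= d ->
    generic A (y + ((-1) ^+ eps * d') *: xi) /\
    forall s, basis A s -> half_open xi eps s y =
      [forall i, 0 < coord A s (y + ((-1) ^+ eps * d') *: xi) 0 i].
Proof.
move=> gxi; pose I : finType := ({s | basis A s} * 'I_N)%type.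
have [p|d d0 Hd] := @small_perturbation _ I
    (fun p => coord A (val p.1) y 0 p.2)
    (fun p => (-1) ^+ eps * coord A (val p.1) xi 0 p.2).
  by rewrite mulf_neq0 ?signr_eq0 // gxi // (valP p.1).
exists d => // d' /Hd {}Hd; split => [s i bs|s bs].
  have [+ _] := Hd (exist _ s bs, i).
  by rewrite coordDE coordZE mulrA (mulrC d').
apply: eq_forallb => i; have [_] := Hd (exist _ s bs, i).
rewrite coordDE coordZE mulrA (mulrC d') /= => ->.
have := gxi s i bs; rewrite /closed_at; move: (coord _ _ _ _ _) => x x0.
have cE z : (0 <= z :> F) = (0 < z) || (z == 0) by rewrite le_eqVlt eq_sym orbC.
rewrite cE; case: eps {Hd}; rewrite ?expr1 ?mulN1r ?expr0 ?mul1r ?oppr_gt0 /=;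
  by case: (ltrgt0P x) x0 => //= _ _; rewrite ?andbT ?andbF ?orbF.
Qed.

Definition same_face s t := [forall j, (j \in codom t) == (j \in codom s)].

(** A basis is an ordered selection, so a simplicial cone arises once for each ordering of its
    generators. [rep] fixes one ordering, so that each cone is counted once. *)
Definition rep s := odflt s [pick t | basis A t && same_face s t].

Lemma basis_rep s : basis A s -> basis A (rep s).
Proof. by rewrite /rep; case: pickP => //= t /andP[]. Qed.

Lemma codom_rep s : codom (rep s) =i codom s.
Proof.
by rewrite /rep; case: pickP => //= t /andP[_ /forallP h] j; apply/eqP.
Qed.

Lemma eq_rep s t : basis A s -> codom s =i codom t -> rep s = rep t.
Proof.
move=> bs st; rewrite /rep.
have st' : same_face s =1 same_face t.
  by move=> u; apply: eq_forallb => j; rewrite st.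
under [in LHS]eq_pick do rewrite st'.
by case: pickP => // /(_ s); rewrite bs -st' /= => /negP[]; apply/forallP.
Qed.

Lemma coord_codom s t y : basis A s -> basis A t -> {subset codom s <= codom t} ->
  nneg (coord A s y) -> nneg (coord A t y).
Proof.
move=> bs bt st ys i; rewrite -(coordK y bs).
rewrite /coord -mulmxA -/(coord A s y) mxE sumr_ge0 // => k _; rewrite mulr_ge0 //.
have /codomP[z ez] : s k \in codom t by apply: st; apply: codom_f.
have -> : (rowsub s A *m invmx (rowsub t A)) k i = coord A t (row (t z) A) 0 i.
  by rewrite /coord -ez -row_mul mul_rowsub_mx [LHS]mxE [RHS]mxE.
by rewrite coord_row // mxE ler0n.
Qed.

Lemma lower_rep om s : lower A om s -> lower A om (rep s).
Proof.
move=> /andP[bs /forallP h].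
have br := basis_rep bs; rewrite /lower br; apply/forallP => j.
rewrite codom_rep; congr (_ ==> (_ < _)): (h j).
rewrite (lift_val_basis om s _ br); apply: eq_bigr => k _; congr (_ * _).
have /codomP[z ->] : rep s k \in codom s by rewrite -codom_rep codom_f.
by rewrite lift_val_row.
Qed.

Variable e : 'cV[F]_N.
Hypotheses (height1 : A *m e = const_mx 1) (fA : row_full A).

(** Existence and uniqueness are both read off at the perturbed point, which is generic and so lies
    in the open cone of exactly one lower simplex. The premise of the last clause holds for points
    of the cone if [eps = false], and for interior points if [eps = true]. *)
Lemma half_open_decomposition :
  exists xi, exists T : {set {ffun 'I_N -> 'I_K}},
  [/\ exists2 mu : 'rV_K, forall j, 0 < mu 0 j & xi = mu *m A,
      forall s, s \in T -> basis A s,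
      generic A xi,
      forall eps s t y, s \in T -> t \in T ->
        half_open xi eps s y -> half_open xi eps t y -> s = t
    & forall eps y d, 0 < d ->
        (forall d', 0 < d' <= d -> cone A (y + ((-1) ^+ eps * d') *: xi)) ->
        exists2 s, s \in T & half_open xi eps s y].
Proof.
(* Each forbidden coincidence is a hyperplane in the space of liftings; its equation is nontrivial
   because the coefficient at [j], which is not in [s], equals 1. *)
have [om _ om_generic] : exists2 om : 'rV[F]_K, forall j, 0 < om 0 j &
    forall s j, basis A s -> j \notin codom s ->
    lift_val A om s (row j A) != om 0 j.
  pose I : finType := {p : {ffun 'I_N -> 'I_K} * 'I_K |
     basis A p.1 && (p.2 \notin codom p.1)}.
  have [p|om om0 Hom] := @avoid_hyperplanes F I K (fun p =>
     delta_mx 0 (val p).2 - \sum_k coord A (val p).1 (row (val p).2 A) 0 k *: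
       delta_mx 0 ((val p).1 k)).
    case: p => [[s j] /= /andP[bs js]].
    apply/eqP => /rowP/(_ j); rewrite !mxE !eqxx summxE big1 ?subr0.
      by move/eqP; rewrite oner_eq0.
    move=> k _; rewrite !mxE /=; case: eqP => [ejk|]; last by rewrite mulr0.
    by rewrite ejk codom_f in js.
  exists om => // s j bs js.
  have bj : basis A (s, j).1 && ((s, j).2 \notin codom (s, j).1) by rewrite bs.
  apply: contra_neq (Hom (exist _ (s, j) bj)) => ej.
  rewrite /= (eq_bigr (fun z => (z == j)%:R * om 0 z -
     \sum_k coord A s (row j A) 0 k * ((z == s k)%:R * om 0 z))); last first.
    move=> z _; rewrite !mxE summxE mulrBl mulr_suml; congr (_ - _).
    by apply: eq_bigr => k _; rewrite [in LHS]mxE -mulrA [X in _ * (X * _)]mxE.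
  have pick k : \sum_z (z == k)%:R * om 0 z = om 0 k.
    rewrite (bigD1 k) //= eqxx mul1r big1 ?addr0 // => z /negPf->.
    by rewrite mul0r.
  rewrite sumrB pick exchange_big /=.
  under eq_bigr do rewrite -mulr_sumr pick.
  by rewrite -ej subrr.
(* The same device makes [xi] generic: the coefficient at the generator [s i] of the [i]-th
   coordinate functional of [s] is 1. *)
have [mu mu0 Hmu] : exists2 mu : 'rV[F]_K, forall j, 0 < mu 0 j &
   forall p : {s | basis A s} * 'I_N,
   \sum_j (\row_j coord A (val p.1) (row j A) 0 p.2) 0 j * mu 0 j != 0.
  apply: avoid_hyperplanes => -[[s bs] i] /=.
  apply/eqP => /rowP/(_ (s i)); rewrite [LHS]mxE [RHS]mxE => /eqP.
  by rewrite coord_row // mxE !eqxx oner_eq0.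
pose xi := mu *m A.
have gxi : generic A xi.
  move=> s i bs; have := Hmu (exist _ s bs, i); congr (_ != _).
  rewrite /xi {2}/coord -mulmxA [RHS]mxE; apply: eq_bigr => j _.
  by rewrite mxE mulrC /coord -row_mul [in LHS]mxE.
pose T := [set s | lower A om s && (s == rep s)].
have TP s : s \in T -> lower A om s /\ basis A s.
  by rewrite inE => /andP[ls _]; split=> //; case/andP: ls.
exists xi, T; split.
- by exists mu.
- by move=> s /TP[].
- exact: gxi.
- move=> eps s t y sT tT; have [[ls bs] [lt bt]] := (TP _ sT, TP _ tT).
  have [d d0 Hd] := half_open_perturb eps y gxi.
  have [|_ H] := Hd d; first by rewrite d0 lexx.
  rewrite !H // => /forallP hs /forallP ht.
  have [ns nt] : nneg (coord A s (y + ((-1) ^+ eps * d) *: xi)) /\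
                 nneg (coord A t (y + ((-1) ^+ eps * d) *: xi)).
    by split=> i; apply: ltW.
  move: sT tT; rewrite !inE => /andP[_ /eqP ->] /andP[_ /eqP ->].
  apply: eq_rep => // j; apply/idP/idP.
    exact: lower_codom ls nt hs j.
  exact: lower_codom lt ns ht j.
- move=> eps y d d0 Cy; have [d1 d10 Hd] := half_open_perturb eps y gxi.
  pose d2 := Num.min d d1.
  have d2P : 0 < d2 by rewrite lt_min d0.
  have [|gz H] := Hd d2; first by rewrite d2P ge_min lexx orbT.
  have [|s ls hs] := lower_exists height1 om_generic fA _ gz.
    by apply: Cy; rewrite d2P ge_min lexx.
  have bs : basis A s by case/andP: ls.
  have br := basis_rep bs.
  exists (rep s).
    rewrite inE lower_rep //=; apply/eqP; apply/eq_rep => // j.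
    by rewrite codom_rep.
  rewrite H //; apply/forallP => i; rewrite lt_def gz //.
  by apply: (coord_codom bs) => // [j|k]; rewrite ?codom_rep // ltW.
Qed.

End HalfOpen.

(** * Counting lattice points *)

Definition compositions n j : seq {ffun 'I_n.+1 -> nat} :=
  [seq [ffun i => nat_of_ord (tnth t i)] |
     t <- enum [set t : n.+1.-tuple 'I_j.+1 | (\sum_(i <- t) i == j)%N]].

Lemma uniq_compositions n j : uniq (compositions n j).
Proof.
rewrite map_inj_uniq ?enum_uniq // => t u /ffunP h.
by apply: eq_from_tnth => i; apply: val_inj; have := h i; rewrite !ffunE.
Qed.

Lemma size_compositions n j : size (compositions n j) = 'C(j + n, n).
Proof. by rewrite size_map -cardE card_ord_partitions addnC. Qed.

Lemma mem_compositions n j k : (k \in compositions n j) = (\sum_i k i == j)%N.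
Proof.
apply/mapP/eqP => [[t]|kj].
  rewrite mem_enum inE big_tuple => /eqP tj ->; rewrite -[RHS]tj.
  by apply: eq_bigr => i _; rewrite ffunE.
have kle i : (k i < j.+1)%N by rewrite ltnS -kj (bigD1 i) //= leq_addr.
exists [tuple inord (k i) | i < n.+1]; last first.
  by apply/ffunP => i; rewrite ffunE tnth_mktuple inordK.
rewrite mem_enum inE big_tuple -[X in _ == X]kj; apply/eqP; apply: eq_bigr => i _.
by rewrite tnth_mktuple inordK.
Qed.

Lemma eq_floor (F : realFieldType) (closed : bool) (c c' : F) (k k' : nat) :
  c + k%:R = c' + k'%:R ->
  (if closed then 0 <= c < 1 else 0 < c <= 1) ->
  (if closed then 0 <= c' < 1 else 0 < c' <= 1) -> k = k'.
Proof.
move=> ec hc hc'; apply/eqP; rewrite eqn_leq.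
by apply/andP; split; rewrite -ltnS -(ltr_nat F) -[ltRHS]natr1;
  case: closed hc hc' => /andP[? ?] /andP[? ?]; lra.
Qed.

Local Notation toQ := (map_mx (intr : int -> rat)).

Section LatticePoints.
Variables (K n : nat) (A : 'M[int]_(K, n.+1)) (e : 'cV[int]_n.+1).
Hypothesis height1 : A *m e = const_mx 1.
Local Notation N := n.+1.
Local Notation AQ := (toQ A).
Implicit Types (s t : {ffun 'I_N -> 'I_K}) (y b : 'rV[int]_N) (eps : bool).

Definition height y : int := (y *m e) 0 0.

Lemma heightD y z : height (y + z) = height y + height z.
Proof. by rewrite /height mulmxDl mxE. Qed.

Lemma heightB y z : height (y - z) = height y - height z.
Proof. by rewrite /height mulmxBl !mxE. Qed.

Lemma height1Q : AQ *m toQ e = const_mx 1.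
Proof. by rewrite -map_mxM height1; apply/matrixP=> i j; rewrite !mxE. Qed.

Lemma height_coord s y : basis AQ s ->
  (height y)%:~R = \sum_i coord AQ s (toQ y) 0 i.
Proof.
move=> bs; have -> : (height y)%:~R = (toQ y *m toQ e) 0 0.
  by rewrite -map_mxM [RHS]mxE.
rewrite -[in LHS](coordK (toQ y) bs) -mulmxA mul_rowsub_mx height1Q [LHS]mxE.
by apply: eq_bigr => i _; rewrite !mxE mulr1.
Qed.

Lemma cone_height y : cone AQ (toQ y) -> 0 <= height y.
Proof.
move=> [l l0 yl]; have : 0 <= (toQ y *m toQ e) 0 0.
  rewrite yl -mulmxA height1Q mxE sumr_ge0 // => j _.
  by rewrite mulr_ge0 // mxE.
by rewrite -map_mxM mxE ler0z.
Qed.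

Definition shift s (k : {ffun 'I_N -> nat}) : 'rV[int]_N :=
  (\row_i (k i)%:R) *m rowsub s A.

Lemma toQ_shift s k : toQ (shift s k) = (\row_i (k i)%:R) *m rowsub s AQ.
Proof.
rewrite map_mxM map_mxsub; congr (_ *m _); apply/matrixP => i j.
by rewrite !mxE natz.
Qed.

Lemma coord_shift s k b i : basis AQ s ->
  coord AQ s (toQ (b + shift s k)) 0 i = coord AQ s (toQ b) 0 i + (k i)%:R.
Proof.
move=> bs; rewrite map_mxD coordDE toQ_shift coord_comb //; congr (_ + _).
by rewrite [LHS]mxE.
Qed.

Lemma height_shift s k : height (shift s k) = (\sum_i k i)%N%:Z.
Proof.
rewrite /height -mulmxA mul_rowsub_mx height1 mxE -[RHS]natz natr_sum.
by apply: eq_bigr => i _; rewrite !mxE mulr1.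
Qed.

Variable xi : 'rV[rat]_N.

(** The fundamental parallelepiped of the half-open cone, with the unit interval closed at 0 on kept
    facets and closed at 1 on removed ones. *)
Definition box eps s b : bool := [forall i, let c := coord AQ s (toQ b) 0 i in
  if closed_at AQ xi eps s i then 0 <= c < 1 else 0 < c <= 1].

Lemma half_open_floor eps s y : basis AQ s -> half_open AQ xi eps s (toQ y) ->
  exists k, box eps s (y - shift s k).
Proof.
move=> bs /forallP H; pose c i := coord AQ s (toQ y) 0 i.
(* On a removed facet the remainder must lie in [(0, 1]], so the ceiling minus one is subtracted in
   place of the floor. *)
exists [ffun i => if closed_at AQ xi eps s i then Num.truncn (c i)
  else if (Num.truncn (c i))%:R < c i then Num.truncn (c i)
  else (Num.truncn (c i)).-1].
set k := finfun _; apply/forallP => i /=.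
have -> : coord AQ s (toQ (y - shift s k)) 0 i = c i - (k i)%:R.
  have := coord_shift k (y - shift s k) i bs; rewrite subrK -/(c i) => ->.
  by rewrite addrK.
rewrite ffunE; have := H i; rewrite -/(c i); case: ifP => _ ci.
  have /andP[h1 h2] := truncn_itv ci.
  by rewrite subr_ge0 h1 ltrBlDl natr1.
have /andP[h1 h2] := truncn_itv (ltW ci).
case: ifP => [h3|/negbT]; first by rewrite subr_gt0 h3 lerBlDl natr1 ltW.
rewrite -leNgt => h3; have e0 : c i = (Num.truncn (c i))%:R by apply/le_anti/andP.
have t0 : (0 < Num.truncn (c i))%N by rewrite -(ltr_nat rat) -e0.
case: (Num.truncn (c i)) e0 t0 => // t -> _ /=.
by rewrite -natr1 [_ + 1]addrC addrK ltr01 lexx.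
Qed.

Lemma box_half_open eps s b k : basis AQ s -> box eps s b ->
  half_open AQ xi eps s (toQ (b + shift s k)).
Proof.
move=> bs /forallP H; apply/forallP => i; have := H i.
rewrite coord_shift //; have k0 : 0 <= (k i)%:R :> rat by apply: ler0n.
by case: ifP => _ /andP[h1 h2]; [exact: addr_ge0 | exact: ltr_wpDr].
Qed.

Lemma box_inj eps s b b' k k' : basis AQ s -> box eps s b -> box eps s b' ->
  b + shift s k = b' + shift s k' -> b = b' /\ k = k'.
Proof.
move=> bs /forallP H /forallP H' ebk.
suff ek : k = k' by split=> //; move: ebk; rewrite ek => /addIr.
apply/ffunP => i; have := H i; have := H' i.
have : coord AQ s (toQ (b + shift s k)) 0 i = coord AQ s (toQ (b' + shift s k')) 0 i.
  by rewrite ebk.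
rewrite !coord_shift //= => ec h h'.
exact: eq_floor ec h' h.
Qed.

Lemma box_height eps s b : basis AQ s -> box eps s b -> 0 <= height b <= N%:Z.
Proof.
move=> bs /forallP H; rewrite -(ler0z rat) -(ler_int rat) (height_coord _ bs).
have cb i : 0 <= coord AQ s (toQ b) 0 i <= 1.
  by have /= := H i; case: ifP => _ /andP[h1 h2];
    apply/andP; split; rewrite ?h1 ?h2 //; apply: ltW.
apply/andP; split; first by rewrite sumr_ge0 // => i _; case/andP: (cb i).
have -> : N%:Z%:~R = \sum_(i < N) 1 :> rat by rewrite sumr_const card_ord.
by apply: ler_sum => i _; case/andP: (cb i).
Qed.

(** Each coordinate [c] becomes [1 - c], which exchanges [[0, 1)] with [(0, 1]]; reversing [eps]
    exchanges kept and removed facets accordingly. *)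
Lemma box_compl s b : basis AQ s -> generic AQ xi ->
  box true s (\sum_i row (s i) A - b) = box false s b.
Proof.
move=> bs gxi; apply: eq_forallb => i.
have -> : toQ (\sum_i row (s i) A - b) = const_mx 1 *m rowsub s AQ - toQ b.
  rewrite map_mxB; congr (_ - _); rewrite mulmx_sum_row (raddf_sum (map_mx intr)).
  apply: eq_bigr => j _; rewrite mxE scale1r; apply/rowP => z.
  by rewrite !mxE.
rewrite coordBE coord_comb // mxE /closed_at addbT addbF.
have := gxi s i bs; move: (coord _ _ _ _ _) (coord _ _ _ _ _) => c x _.
rewrite if_neg; case: ifP => _.
  by apply/andP/andP => -[h1 h2]; split; lra.
by apply/andP/andP => -[h1 h2]; split; lra.
Qed.

Variable T : {set {ffun 'I_N -> 'I_K}}.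
Hypotheses (basisT : forall s, s \in T -> basis AQ s)
  (T_uniq : forall eps s t (y : 'rV[rat]_N), s \in T -> t \in T -> half_open AQ xi eps s y ->
     half_open AQ xi eps t y -> s = t).

Definition covered eps y := [exists s in T, half_open AQ xi eps s (toQ y)].

(** A covered lattice point is uniquely a box point plus a natural combination of the [n + 1]
    generators of its cone. These have height 1, so a box point of height [k] contributes the
    compositions of [m - k] into [n + 1] parts. *)
Lemma count_covered eps (B : seq ({ffun 'I_N -> 'I_K} * 'rV[int]_N)) L m :
  uniq B -> (forall s b, ((s, b) \in B) = (s \in T) && box eps s b) ->
  uniq L -> (forall y, (y \in L) = covered eps y && (height y == m%:Z)) ->
  size L = (\sum_(p <- B)
    if `|height p.2| <= m then 'C(m - `|height p.2| + n, n) else 0)%N.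
Proof.
move=> uB memB uL memL.
pose S := [seq p <- B | (`|height p.2| <= m)%N].
pose f (p : {ffun 'I_N -> 'I_K} * 'rV[int]_N) k := p.2 + shift p.1 k.
have BP p : p \in B -> p.1 \in T /\ box eps p.1 p.2.
  by case: p => s b; rewrite memB => /andP[].
have nneg_ht p : p \in B -> height p.2 = `|height p.2|%N%:Z.
  by move=> /BP[/basisT bs /(box_height bs)/andP[h _]]; rewrite gez0_abs.
rewrite -big_mkcond /= -big_filter -/S.
have -> : size L = size
    [seq f p k | p <- S, k <- compositions n (m - `|height p.2|)].
  apply: perm_size; apply: uniq_perm => //.
    apply: (@allpairs_uniq_dep _ (fun=> _)) => [||[p k] [p' k']].
    - by rewrite filter_uniq.
    - by move=> p _; apply: uniq_compositions.
    move=> /allpairsPdep[q [l [qS _ [-> ->]]]].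
    move=> /allpairsPdep[q' [l' [q'S _ [-> ->]]]]; rewrite /f /= => eq.
    move: qS q'S; rewrite !mem_filter => /andP[_ /BP[qT bq]] /andP[_ /BP[qT' bq']].
    case: q q' qT bq qT' bq' eq => [s b] [s' b'] /= sT bb s'T bb' eq.
    have ess' : s = s'.
      apply: (T_uniq sT s'T (box_half_open l (basisT sT) bb)).
      by rewrite eq; apply: box_half_open (basisT s'T) bb'.
    rewrite -ess' in bb' eq *; by have [-> ->] := box_inj (basisT sT) bb bb' eq.
  move=> y; rewrite memL; apply/andP/allpairsPdep => [[/exists_inP[s sT sy]]|].
    move=> /eqP hy; have bs := basisT sT.
    have [k bk] := half_open_floor bs sy.
    have pB : (s, y - shift s k) \in B by rewrite memB sT.
    have hE : height (y - shift s k) = m%:Z - (\sum_i k i)%N%:Z.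
      by rewrite heightB hy height_shift.
    have := nneg_ht _ pB; rewrite /= hE => hN.
    exists (s, y - shift s k), k; split; last by rewrite /f subrK.
      by rewrite mem_filter pB andbT /= hE; lia.
    rewrite mem_compositions /= hE; move: (\sum_i k i)%N hN => j hN.
    by apply/eqP; lia.
  move=> [[s b] [k []]]; rewrite mem_filter mem_compositions => /andP[/= hb pB] /eqP hk ->.
  have [sT bb] := BP _ pB; split.
    by apply/exists_inP; exists s => //; apply: box_half_open (basisT sT) bb.
  by rewrite heightD height_shift hk (nneg_ht _ pB) /=; lia.
rewrite size_allpairs_dep sumnE big_map; apply: eq_bigr => p _.
exact: size_compositions.
Qed.

End LatticePoints.

(** * Reciprocity and the Gorenstein point *)

Section GorensteinPoint.
Variables (K n : nat) (A : 'M[int]_(K, n.+1)) (e : 'cV[int]_n.+1).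
Hypotheses (height1 : A *m e = const_mx 1) (fA : row_full (toQ A)).
Variables (L : nat -> seq 'rV[int]_n.+1) (h : {poly int}).
Local Notation N := n.+1.
Local Notation AQ := (toQ A).
Local Notation height := (height e).
Hypothesis uniqL : forall m, uniq (L m).
Hypothesis memL : forall m y,
  y \in L m <-> cone AQ (toQ y) /\ height y = m%:Z.
Hypothesis sizeL : forall m, (size (L m))%:Z =
  \sum_(i < size h | (i <= m)%N) h`_i * ('C(m - i + n, n))%:Z.
Hypothesis symh : gorenstein_hstar h.

(** For [xi] inside the cone this is the topological interior, expressed without topology. *)
Definition interior (xi : 'rV[rat]_N) (y : 'rV[int]_N) : Prop :=
  exists2 d : rat, 0 < d & cone AQ (toQ y - d *: xi).

Local Notation term m k := (if k <= m then 'C(m - k + n, n) else 0)%N.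

(** The origin is counted at height 0, so [h] is nonzero and the truncated predecessor in [hdeg] is
    harmless. *)
Lemma size_hstar : size h = (hdeg h).+1.
Proof.
rewrite /hdeg prednK // lt0n; apply/negP => /eqP h0.
have : (size (L 0))%:Z = 0 by rewrite sizeL h0 big_ord0.
have : 0 \in L 0.
  by apply/memL; split; rewrite ?map_mx0 /height ?mul0mx ?mxE //; apply: cone0.
by case: (L 0).
Qed.

Lemma hstar_lead : h`_(hdeg h) != 0.
Proof.
have : lead_coef h != 0 by rewrite lead_coef_eq0 -size_poly_eq0 size_hstar.
by rewrite lead_coefE.
Qed.

Lemma sum_hstar M (G : nat -> int) : (size h <= M)%N ->
  \sum_(k < M) h`_k * G k = \sum_(k < size h) h`_k * G k.
Proof.
move=> hM; rewrite [RHS](big_ord_widen M (fun k => h`_k * G k)) // [RHS]big_mkcond.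
apply: eq_bigr => k _; case: ltnP => // kh.
by rewrite nth_default // mul0r.
Qed.

Lemma sizeL_term m :
  (size (L m))%:Z = \sum_(k < size h) h`_k * (term m k)%:Z.
Proof.
rewrite sizeL big_mkcond; apply: eq_bigr => k _.
by case: ifP => _; rewrite ?mulr0.
Qed.

(* The numbers [binom(m - k + n, n)] form a unitriangular system. *)
Lemma hstar_count (cB : nat -> nat) (M : nat) : (size h <= M)%N ->
  (forall m, size (L m) = \sum_(k < M) cB k * term m k)%N ->
  forall k, (k < M)%N -> (cB k)%:Z = h`_k.
Proof.
move=> hM sizeB.
have eqm m : \sum_(k < M) ((cB k)%:Z - h`_k) * (term m k)%:Z = 0.
  under eq_bigr do rewrite mulrBl.
  rewrite sumrB; apply/eqP; rewrite subr_eq0; apply/eqP.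
  rewrite (sum_hstar (fun k => (term m k)%:Z) hM) -sizeL_term sizeB.
  rewrite -[RHS]natz natr_sum; apply: eq_bigr => k _.
  by rewrite natz PoszM.
move=> k; have [m] := ubnP k; elim: m k => // m IH k; rewrite ltnS => km kM.
apply/eqP; rewrite -subr_eq0; apply/eqP.
have := eqm k; rewrite (bigD1 (Ordinal kM)) //= leqnn subnn add0n binn mulr1.
rewrite big1 ?addr0 // => j jk; have {}jk : (j != k :> nat) by apply: contra_neq jk => ejk; apply: val_inj.
case: leqP => jk'; last by rewrite mulr0.
have ltjk : (j < k)%N by rewrite ltn_neqAle jk.
by rewrite IH ?subrr ?mul0r //; apply: leq_trans km.
Qed.

Lemma sum_count (I : eqType) (s : seq I) (f : I -> nat) (G : nat -> nat) M :
  {in s, forall i, (f i < M)%N} ->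
  (\sum_(i <- s) G (f i) = \sum_(k < M) count (fun i => f i == k) s * G k)%N.
Proof.
elim: s => [|i s IH] fM; first by rewrite big_nil big1.
rewrite big_cons IH => [|j js]; last by rewrite fM // inE js orbT.
under [RHS]eq_bigr do rewrite /= mulnDl.
rewrite big_split /=; congr (_ + _)%N.
have fi : (f i < M)%N by rewrite fM // inE eqxx.
rewrite (bigD1 (Ordinal fi)) //= eqxx mul1n big1 ?addn0 // => k ki.
by rewrite (_ : (f i == k) = false) // eq_sym; apply: contra_neqF ki => /eqP ?; apply: val_inj.
Qed.

(* Ehrhart reciprocity turns the symmetry of [h] into a bijection between the
   lattice points of the cone at height [m] and the interior ones at height
   [r + m]; translation by the unique interior point at height [r] is an
   injection between the same finite sets. *)
Lemma gorenstein_point : exists (x : 'rV[int]_N) (xi : 'rV[rat]_N) (r : nat),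
  [/\ (r + hdeg h = N)%N, height x = r%:Z,
      exists2 mu : 'rV_K, forall j, 0 < mu 0 j & xi = mu *m AQ,
      interior xi x
    & forall y, interior xi y -> cone AQ (toQ (y - x))].
Proof.
have [xi [T [xi_pos basisT gxi T_uniq T_cover]]] :=
  half_open_decomposition (height1Q height1) fA.
have xiC : cone AQ xi.
  by case: xi_pos => mu mu0 ->; exists mu => // j; apply: ltW.
have ho_cone eps s y : s \in T -> half_open AQ xi eps s y -> cone AQ y.
  move=> sT /forallP H; apply: coord_cone (basisT s sT) _ => i.
  by have := H i; case: ifP => // _ /ltW.
have covC y : cone AQ (toQ y) <-> covered A xi T false y.
  split=> [Cy|/exists_inP[s sT]]; last exact: ho_cone.
  have [|s sT sy] := T_cover false (toQ y) 1 ltr01.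
    move=> d /andP[d0 _]; rewrite expr0 mul1r; apply: coneD => //.
    by apply: coneZ => //; apply: ltW.
  by apply/exists_inP; exists s.
have covI y : interior xi y <-> covered A xi T true y.
  split=> [[d d0 Cy]|/exists_inP[s sT sy]].
    have [|s sT sy] := T_cover true (toQ y) d d0.
      move=> d' /andP[d'0 d'd]; rewrite expr1 mulN1r scaleNr.
      have -> : toQ y - d' *: xi = (toQ y - d *: xi) + (d - d') *: xi.
        by rewrite scalerBl addrA subrK.
      by apply: coneD => //; apply: coneZ; rewrite ?subr_ge0.
    by apply/exists_inP; exists s.
  have [d d0 /(_ d)[|_ H]] := half_open_perturb true (toQ y) gxi.
    by rewrite d0 lexx.
  exists d => //; apply: coord_cone (basisT s sT) _ => i.
  have := H s (basisT s sT); rewrite sy => /esym/forallP/(_ i)/ltW.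
  by rewrite expr1 mulN1r scaleNr.
(* Box points have height between 0 and [N], so the lists [L 0, ..., L N] contain all of them and
   [B] is a finite enumeration. *)
pose cand := flatten [seq L k | k <- iota 0 N.+1].
pose B := undup [seq p <- [seq (s, b) | s <- enum T, b <- cand]
                | box A xi false p.1 p.2].
have memB s b : ((s, b) \in B) = (s \in T) && box A xi false s b.
  rewrite mem_undup mem_filter /= andbC; apply/andP/andP => [[/allpairsP + bb]|].
    by move=> [[s' b'] /= [sT _ [es _]]]; rewrite mem_enum -es in sT.
  move=> [sT bb]; split=> //; apply/allpairsP; exists (s, b); split=> //=.
    by rewrite mem_enum.
  have bs := basisT s sT.
  have /andP[h0 hN] := box_height height1 bs bb.
  apply/flatten_mapP; exists `|height b|%N; first by rewrite mem_iota; lia.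
  apply/memL; split; last by rewrite gez0_abs.
  have k0 : shift A s [ffun=> 0%N] = 0.
    rewrite /shift (_ : \row__ _ = 0) ?mul0mx //.
    by apply/rowP => i; rewrite !mxE ffunE.
  by have /(ho_cone _ _ _ sT) := box_half_open [ffun=> 0%N] bs bb; rewrite k0 addr0.
pose htB (p : {ffun 'I_N -> 'I_K} * 'rV[int]_N) := `|height p.2|%N.
have BP p : p \in B -> height p.2 = (htB p)%:Z /\ (htB p <= N)%N.
  case: p => s b; rewrite memB => /andP[sT bb].
  have /andP[h0 hN] := box_height height1 (basisT s sT) bb.
  by rewrite /htB /= gez0_abs // -lez_nat gez0_abs.
have uB : uniq B by apply: undup_uniq.
pose cB k := count (fun p => htB p == k) B.
pose M := maxn N.+1 (size h).
have hM : (size h <= M)%N by apply: leq_maxr.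
have htM p : p \in B -> (htB p < M)%N.
  by move=> /BP[_ hN]; apply: leq_trans (leq_maxl _ _).
(* The coefficient [h_k] counts the box points of height [k]. *)
have cBh k : (k < M)%N -> (cB k)%:Z = h`_k.
  apply: hstar_count hM _ k => m.
  rewrite (count_covered height1 basisT T_uniq (m := m) uB memB (uniqL m)).
    by rewrite (@sum_count _ B htB (fun k => term m k) M).
  by move=> y; apply/idP/andP => [/memL[/covC -> ->]|[/covC cy /eqP hy]] //; apply/memL.
pose d := hdeg h; have sizeh : size h = d.+1 := size_hstar.
have dN : (d <= N)%N.
  have : (0 < cB d)%N.
    by rewrite lt0n -eqz_nat cBh ?hstar_lead // -sizeh.
  by rewrite -has_count => /hasP[p /BP[_ hp] /eqP <-].
pose r := (N - d)%N.
(* Complementation turns the boxes for [xi] into those for [- xi] and height [k] into [N - k]; this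
   yields the reciprocal count [sizeI] of interior points. *)
pose flip (p : {ffun 'I_N -> 'I_K} * 'rV[int]_N) :=
  (p.1, \sum_i row (p.1 i) A - p.2).
pose B' := [seq flip p | p <- B].
have memB' s b : ((s, b) \in B') = (s \in T) && box A xi true s b.
  apply/mapP/andP => [[[s' b'] pB [-> ->]]|[sT bb]].
    by move: pB; rewrite memB => /andP[sT bb]; rewrite box_compl //; apply: basisT.
  exists (s, \sum_i row (s i) A - b); last by rewrite /flip /= opprB addrC subrK.
  rewrite memB sT -box_compl ?opprB; [|exact: basisT|done].
  by rewrite addrC subrK.
have uB' : uniq B'.
  rewrite map_inj_uniq // => -[s b] [s' b'] [/= <-] /addrI/oppr_inj -> //.
have htB' u : u \in B -> `|height (flip u).2|%N = (N - htB u)%N.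
  move=> /BP[hp hN]; rewrite heightB hp.
  have -> : height (\sum_i row (u.1 i) A) = N%:Z.
    rewrite /height mulmx_suml summxE -[N in RHS]card_ord -sum1_card -[RHS]natz natr_sum.
    by apply: eq_bigr => i _; rewrite -row_mul height1 !mxE.
  by rewrite subzn.
pose I m := [seq y <- L m | covered A xi T true y].
have memI m y : y \in I m <-> interior xi y /\ height y = m%:Z.
  rewrite mem_filter; split=> [/andP[/covI iy /memL[_ hy]] //|[/covI iy hy]].
  rewrite iy; apply/memL; split=> //.
  by case/exists_inP: iy => s sT; apply: ho_cone sT.
have sizeI m : (size (I m))%:Z =
    \sum_(k < d.+1) h`_k * (term m (N - k))%:Z.
  have uI : uniq (I m) by rewrite filter_uniq.
  rewrite (count_covered height1 basisT T_uniq (m := m) uB' memB' uI); last first.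
    move=> y; apply/idP/andP => [/memI[/covI -> ->] //|[/covI iy /eqP hy]].
    exact/memI.
  rewrite big_map (eq_big_seq (fun p => term m (N - htB p))); last first.
    by move=> p pB /=; rewrite htB'.
  rewrite (@sum_count _ B htB (fun k => term m (N - k)) M) //.
  rewrite -sizeh -(sum_hstar (fun k => (term m (N - k))%:Z) hM).
  rewrite -[LHS]natz natr_sum; apply: eq_bigr => k _.
  by rewrite natz PoszM cBh.
(* Symmetry of [h] allows the substitution of [d - k] for [k], and [N - (d - k) = r + k]. *)
have sizeIr m : size (I (r + m)%N) = size (L m).
  apply/eqP; rewrite -eqz_nat sizeI sizeL_term sizeh; apply/eqP.
  rewrite (reindex_inj rev_ord_inj) /=; apply: eq_bigr => k _.
  have kd : (k <= d)%N by rewrite -ltnS.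
  rewrite subSS symh -/d; last by apply: leq_subr.
  rewrite subKn //; congr (_ * _%:Z).
  have -> : (N - (d - k) <= r + m)%N = (k <= m)%N by rewrite /r; lia.
  by case: ifP => // km; congr ('C(_ + _, _)); rewrite /r; lia.
have L0 : 0 \in L 0.
  by apply/memL; split; rewrite ?map_mx0 /height ?mul0mx ?mxE //; apply: cone0.
have [x xI] : exists x, x \in I r.
  have : (0 < size (I r))%N by rewrite -[r]addn0 sizeIr; case: (L 0) L0.
  by case: (I r) => // x l _; exists x; rewrite inE eqxx.
have [ix hx] := (memI r x).1 xI.
exists x, xi, r; split=> //; first by rewrite /r subnK.
move=> y iy; have Cy : cone AQ (toQ y).
  by have /covI/exists_inP[s sT] := iy; apply: ho_cone.
have hy : height y = `|height y|%N by rewrite gez0_abs // (cone_height height1 Cy).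
set m := `|height y|%N in hy.
have yI : y \in I m by apply/memI.
(* The flipped boxes that count have height at least [N - d = r], so no interior point lies
   lower. *)
have rm : (r <= m)%N.
  rewrite leqNgt; apply/negP => mr.
  have : (size (I m))%:Z = 0.
    rewrite sizeI big1 // => k _; have kd : (k <= d)%N by rewrite -ltnS.
    have -> : (N - k <= m)%N = false by rewrite /r in mr; lia.
    by rewrite mulr0.
  by case: (I m) yI.
pose J := [seq c + x | c <- L (m - r)].
have uJ : uniq J by rewrite map_inj_uniq //; apply: addIr.
have [||_ JI] := @uniq_min_size _ J (I m) uJ.
- move=> z /mapP[c /memL[Cc hc] ->]; apply/memI; split; last first.
    by rewrite heightD hc hx; lia.
  case: ix => d' d'0 Cx; exists d' => //; rewrite map_mxD -addrA.
  exact: coneD.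
- by rewrite size_map -sizeIr subnKC.
move: yI; rewrite -JI => /mapP[c /memL[Cc _] ->].
by rewrite addrK.
Qed.

End GorensteinPoint.

(** * Facets of the dual cone *)

Lemma row_full_ker0 (F : fieldType) K N k (A : 'M[F]_(K, N)) (w : 'M[F]_(N, k)) :
  row_full A -> A *m w = 0 -> w = 0.
Proof.
by case/row_fullP => B BA h; rewrite -[w]mul1mx -BA -mulmxA h mulmx0.
Qed.

Section DualCone.
Variables (F : realFieldType) (K n : nat) (A : 'M[F]_(K, n.+1)).
Variables (mu : 'rV[F]_K).
Hypotheses (mu_gt0 : forall j, 0 < mu 0 j) (fA : row_full A).
Local Notation N := n.+1.
Local Notation x := (mu *m A).
Implicit Types (w : 'cV[F]_N).

Definition dual w := forall j, 0 <= (A *m w) j 0.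

Definition zero_rows w : 'M[F]_(K, N) :=
  \matrix_j (if (A *m w) j 0 == 0 then row j A else 0).

(** Vanishing on generators of rank [n] means spanning an extreme ray of the dual cone; the value at
    the interior point [x] fixes the scale. *)
Definition facet w := [/\ dual w, (x *m w) 0 0 = 1 & \rank (zero_rows w) = n].

Lemma dual_eval w : (x *m w) 0 0 = \sum_j mu 0 j * (A *m w) j 0.
Proof. by rewrite -mulmxA mxE. Qed.

Lemma dual_eval_ge0 w : dual w -> 0 <= (x *m w) 0 0.
Proof.
by move=> dw; rewrite dual_eval sumr_ge0 // => j _; rewrite mulr_ge0 // ltW.
Qed.

(** As [x] is a strictly positive combination of the generators, [w] vanishes on each of them, and
    they span. *)
Lemma dual_eval0 w : dual w -> (x *m w) 0 0 = 0 -> w = 0.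
Proof.
move=> dw; rewrite dual_eval => /psumr_eq0P h; apply: (row_full_ker0 fA).
apply/matrixP => j k; rewrite ord1 [RHS]mxE.
have /eqP : mu 0 j * (A *m w) j 0 = 0.
  by apply: h => // i _; rewrite mulr_ge0 // ltW.
by rewrite mulf_eq0 gt_eqF //= => /eqP.
Qed.

Lemma zero_rows_mul w : zero_rows w *m w = 0.
Proof.
apply/row_matrixP => j; rewrite row_mul rowK row0.
case: eqP => [h|]; last by rewrite mul0mx.
by rewrite -row_mul; apply/matrixP => a b; rewrite !ord1 [LHS]mxE h mxE.
Qed.

Lemma dualZ a w : 0 <= a -> dual w -> dual (a *: w).
Proof. by move=> a0 dw j; rewrite -scalemxAr mxE mulr_ge0. Qed.

Lemma zero_rowsZ a w : a != 0 -> zero_rows (a *: w) = zero_rows w.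
Proof.
move=> a0; apply/row_matrixP => j; rewrite !rowK -scalemxAr mxE.
by rewrite mulf_eq0 (negPf a0).
Qed.

(* Moving from [w] in a direction vanishing on its zero generators until the
   boundary of the dual cone is hit creates a new zero. *)
Lemma dual_boundary w w' : dual w -> zero_rows w *m w' = 0 ->
  (exists j, (A *m w') j 0 < 0) ->
  exists2 t, 0 < t & dual (w + t *: w') /\
    (\rank (zero_rows w) < \rank (zero_rows (w + t *: w')))%N.
Proof.
move=> dw zw [j0 hj0].
have zero j : (A *m w) j 0 = 0 -> (A *m w') j 0 = 0.
  move=> wj; have : (row j (zero_rows w *m w')) 0 0 = 0 by rewrite zw !mxE.
  by rewrite row_mul rowK wj eqxx -row_mul mxE.
have [||i ci Hi] := @ratio_test _ _ (A *m w)^T (- (A *m w')^T).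
- by move=> k; rewrite mxE.
- by exists j0; rewrite 2!mxE oppr_gt0.
move: ci; rewrite 2!mxE oppr_gt0 => ci.
have {}Hi k : 0 <= (A *m w) k 0 - (A *m w) i 0 / (A *m w') i 0 * (A *m w') k 0.
  have := Hi k; rewrite [X in 0 <= X - _]mxE.
  have trE : forall z, (- (A *m w')^T) 0 z = - (A *m w') z 0.
    by move=> z; rewrite 2!mxE.
  have trE' z : (A *m w)^T 0 z = (A *m w) z 0 by rewrite mxE.
  by rewrite !trE !trE' invrN !mulrN mulNr opprK.
have wi : 0 < (A *m w) i 0.
  by rewrite lt_def dw andbT; apply/eqP => /zero h; rewrite h ltxx in ci.
pose t := - ((A *m w) i 0 / (A *m w') i 0).
have t0 : 0 < t by rewrite oppr_gt0 pmulr_rlt0 // invr_lt0.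
have AE k : (A *m (w + t *: w')) k 0 = (A *m w) k 0 + t * (A *m w') k 0.
  by rewrite mulmxDr -scalemxAr [LHS]mxE; congr (_ + _); rewrite mxE.
exists t => //; split; first by move=> k; rewrite AE mulNr.
have zi : (A *m (w + t *: w')) i 0 = 0.
  by rewrite AE /t mulNr divfK ?subrr // lt_eqF.
apply: rank_ltmx; apply/andP; split.
  apply/row_subP => j; rewrite rowK; case: eqP => [wj|]; last by rewrite sub0mx.
  have : row j (zero_rows (w + t *: w')) = row j A.
    by rewrite rowK AE wj zero // mulr0 addr0 eqxx.
  by move=> <-; apply: row_sub.
(* Row [i] is not in the old span: [w'] vanishes on the old zero rows but is negative on generator
   [i]. *)
apply/negP => /(submx_trans (row_sub i _)); rewrite rowK zi eqxx.
move=> /submxP[c ec]; move: ci.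
have -> : (A *m w') i 0 = (row i A *m w') 0 0 by rewrite -row_mul [RHS]mxE.
by rewrite ec -mulmxA zw mulmx0 mxE ltxx.
Qed.

(** A single matrix [W] serves the whole list, so that Caratheodory's theorem can later be applied
    to its rows. *)
Definition facet_comb (s : seq 'cV[F]_N) := exists k (W : 'M[F]_(k, N)),
  (forall i, facet (row i W)^T) /\ forall w, w \in s -> cone W w^T.

Lemma cone_col_mx k1 k2 (W1 : 'M[F]_(k1, N)) (W2 : 'M[F]_(k2, N)) y :
  cone W1 y \/ cone W2 y -> cone (col_mx W1 W2) y.
Proof.
case=> [[l l0 ->]|[l l0 ->]].
  exists (row_mx l 0); last by rewrite mul_row_col mul0mx addr0.
  by move=> i; rewrite mxE; case: split => // j; rewrite mxE.
exists (row_mx 0 l); last by rewrite mul_row_col mul0mx add0r.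
by move=> i; rewrite mxE; case: split => // j; rewrite mxE.
Qed.

Lemma facet_comb_cat s s' : facet_comb s -> facet_comb s' -> facet_comb (s ++ s').
Proof.
move=> [k [W [fW sW]]] [k' [W' [fW' sW']]]; exists (k + k')%N, (col_mx W W').
split=> [i|w].
  by rewrite -[i]splitK; case: split => j /=; rewrite ?rowKu ?rowKd.
rewrite mem_cat => /orP[/sW|/sW'] h; apply: cone_col_mx; [by left | by right].
Qed.

(** Induction on the corank of the zero rows. Below rank [n], [w] lies strictly between two dual
    functionals with more zeros, reached by moving in opposite directions. *)
Lemma facet_comb1 w : dual w -> facet_comb [:: w].
Proof.
have [m] := ubnP (N - \rank (zero_rows w)); elim: m w => // m IH w.
rewrite ltnS => hm dw; have [xw|xw] := eqVneq ((x *m w) 0 0) 0.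
  exists 0%N, 0; split=> [[]//|w']; rewrite inE => /eqP ->.
  by rewrite (dual_eval0 dw xw) trmx0; apply: cone0.
have xw0 : 0 < (x *m w) 0 0 by rewrite lt_def xw dual_eval_ge0.
have w0 : w != 0 by apply: contra_neq xw => ->; rewrite mulmx0 mxE.
have rw : (\rank (zero_rows w) <= n)%N.
  rewrite -ltnS ltn_neqAle rank_leq_col andbT; apply: contra_neq w0 => fz.
  have /row_fullP[B BZ] : row_full (zero_rows w) by rewrite /row_full fz.
  by rewrite -[w]mul1mx -BZ -mulmxA zero_rows_mul mulmx0.
have [rwn|rwn] := eqVneq (\rank (zero_rows w)) n.
  exists 1%N, (((x *m w) 0 0)^-1 *: w^T); split=> [i|w'].
    rewrite [row i _](_ : _ = ((x *m w) 0 0)^-1 *: w^T); last first.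
      by apply/rowP => j; rewrite !ord1 mxE.
    rewrite linearZ /= trmxK; split.
    - by apply: dualZ => //; rewrite invr_ge0 ltW.
    - by rewrite -scalemxAr mxE mulVf.
    - by rewrite zero_rowsZ // invr_eq0.
  rewrite inE => /eqP ->; exists (const_mx ((x *m w) 0 0)).
    by move=> j; rewrite mxE ltW.
  have -> : const_mx ((x *m w) 0 0) = ((x *m w) 0 0)%:M :> 'M_1.
    by apply/matrixP => i j; rewrite !ord1 [LHS]mxE [RHS]mxE.
  by rewrite mul_scalar_mx scalerA mulfV // scale1r.
have {}rwn : (\rank (zero_rows w) < n)%N by rewrite ltn_neqAle rwn.
(* Requiring also [x *m w' = 0] forces both [w'] and [- w'] to be negative on some generator, so the
   boundary is reached either way. Rank below [n] leaves room for this extra equation. *)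
have [w' [w'0 zw' xw']] : exists w', [/\ w' != 0, zero_rows w *m w' = 0 & x *m w' = 0].
  have : kermx (col_mx (zero_rows w) x)^T != 0.
    rewrite kermx_eq0 /row_free mxrank_tr neq_ltn; apply/orP; left.
    rewrite -addsmxE; apply: leq_ltn_trans (mxrank_adds_leqif _ _) _.
    by rewrite ltnS; apply: leq_trans (leq_add (leqnn _) (rank_leq_row _)) _; rewrite addn1.
  move=> /rowV0Pn[v /sub_kermxP h v0]; exists v^T.
  have : col_mx (zero_rows w) x *m v^T = 0.
    by apply: trmx_inj; rewrite trmx_mul trmxK h trmx0.
  rewrite mul_col_mx => /eqP; rewrite col_mx_eq0 => /andP[/eqP h1 /eqP h2].
  by split=> //; apply: contra_neq v0 => hv; rewrite -[v]trmxK hv trmx0.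
have signs (v : 'cV[F]_N) : v != 0 -> x *m v = 0 -> exists j, (A *m v) j 0 < 0.
  move=> v0 xv; apply/existsP; apply: contraT => /existsPn h.
  suff v00 : v = 0 by rewrite v00 eqxx in v0.
  by apply: dual_eval0 => [j|]; [rewrite leNgt | rewrite xv mxE].
have [t t0 [dt rt]] := dual_boundary dw zw' (signs _ w'0 xw').
have [||t' t'0 [dt' rt']] := @dual_boundary w (- w') dw.
- by rewrite mulmxN zw' oppr0.
- by apply: signs; rewrite ?oppr_eq0 // mulmxN xw' oppr0.
have [k [W [fW hW]]] : facet_comb ([:: w + t *: w'] ++ [:: w + t' *: - w']).
  by apply: facet_comb_cat; apply: IH => //;
    apply: leq_trans hm; apply: ltn_sub2l => //; rewrite ltnS ltnW.
exists k, W; split=> // v; rewrite inE => /eqP ->.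
have tt : 0 < t + t' by rewrite addr_gt0.
have -> : w^T = (t + t')^-1 *: (t' *: (w + t *: w')^T + t *: (w + t' *: - w')^T).
  apply: (scalerI (lt0r_neq0 tt)); rewrite scalerA divff ?gt_eqF // scale1r.
  apply/rowP => j; rewrite !mxE; ring.
apply: coneZ; first by rewrite invr_ge0 ltW.
by apply: coneD; apply: coneZ; rewrite ?ltW //; apply: hW;
  rewrite mem_cat !inE eqxx ?orbT.
Qed.

Lemma facet_comb_all s : (forall w, w \in s -> dual w) -> facet_comb s.
Proof.
elim: s => [|w s IH] ds.
  by exists 0%N, 0; split=> [[]//|w']; rewrite in_nil.
apply: (@facet_comb_cat [:: w]).
  by apply: facet_comb1; apply: ds; rewrite inE eqxx.
by apply: IH => v vs; apply: ds; rewrite inE vs orbT.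
Qed.

(** The functionals [e] and [c *: e + delta_mx i 0] are dual and span the whole space, hence so do
    the facets generating them; Caratheodory's theorem for [e] then selects a basis. *)
Lemma facet_basis (e : 'cV[F]_N) : (forall j, 0 < (A *m e) j 0) ->
  exists (W : 'M[F]_N) (l : 'rV[F]_N), [/\ forall i, facet (row i W)^T,
    W \in unitmx, nneg l & e^T = l *m W].
Proof.
move=> e0.
have [c Hc] : exists c, forall i, dual (c *: e + delta_mx i 0).
  (* This sum dominates every ratio, so one constant works for all generators and coordinates. *)
  exists (\sum_j \sum_i `|A j i| / (A *m e) j 0) => i j.
  rewrite mulmxDr -scalemxAr -colE [X in 0 <= X]mxE [X in X + _]mxE [X in _ + X]mxE.
  rewrite addrC -lerBlDl sub0r; apply: le_trans (_ : `|A j i| <= _).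
    by rewrite -normrN ler_norm.
  rewrite -ler_pdivrMr // (bigD1 j) //= (bigD1 i) //= -addrA lerDl.
  rewrite addr_ge0 // ?sumr_ge0 // => k _; first by rewrite divr_ge0 // ltW.
  by rewrite sumr_ge0 // => z _; rewrite divr_ge0 // ltW.
have [|k [W [fW hW]]] := @facet_comb_all (e :: [seq c *: e + delta_mx i 0 | i <- enum 'I_N]).
  move=> w; rewrite inE => /orP[/eqP -> j|/mapP[i _ ->] //].
  exact: ltW.
have sub w : cone W w^T -> (w^T <= W)%MS by move=> [l _ ->]; apply: submxMl.
have We : cone W e^T by apply: hW; rewrite inE eqxx.
have fullW : row_full W.
  rewrite -sub1mx; apply/row_subP => i; rewrite row1.
  have -> : delta_mx 0 i = (c *: e + delta_mx i 0)^T - c *: e^T.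
    by apply/rowP => j; rewrite !mxE [j == i]eq_sym andbC; ring.
  apply: addmx_sub; last by rewrite eqmx_opp; apply/scalemx_sub/sub.
  apply/sub/hW; rewrite inE; apply/orP; right; apply/mapP.
  by exists i; rewrite ?mem_enum.
have [s bs es] := caratheodory fullW We.
exists (rowsub s W), (coord W s e^T); split=> // [i|]; last by rewrite coordK.
by rewrite row_rowsub.
Qed.

End DualCone.

(** * Decomposing the height functional *)

Lemma toQ_inj m n : injective (map_mx (intr : int -> rat) : 'M_(m, n) -> _).
Proof.
move=> A B /matrixP h; apply/matrixP => i j.
by apply: (intr_inj (R := rat)); have := h i j; rewrite !mxE.
Qed.

Section HeightDecomposition.
Variables (K n : nat) (A : 'M[int]_(K, n.+1)) (e : 'cV[int]_n.+1).
Local Notation N := n.+1.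
Local Notation AQ := (toQ A).
Local Notation height := (height e).
Hypotheses (height1 : A *m e = const_mx 1) (fA : row_full AQ).
Variables (x : 'rV[int]_N) (xi : 'rV[rat]_N) (mu nu : 'rV[rat]_K).
Hypotheses (mu_gt0 : forall j, 0 < mu 0 j) (xiE : xi = mu *m AQ).
Hypotheses (nu_gt0 : forall j, 0 < nu 0 j) (xE : toQ x = nu *m AQ).
Hypothesis int_sub : forall y, interior A xi y -> cone AQ (toQ (y - x)).

Lemma cone_eval (y : 'rV[rat]_N) (w : 'cV[rat]_N) :
  cone AQ y -> dual AQ w -> 0 <= (y *m w) 0 0.
Proof.
move=> [l l0 ->] dw; rewrite -mulmxA mxE sumr_ge0 // => j _.
by rewrite mulr_ge0.
Qed.

(* Adding a large multiple of the sum of the generators of the facet moves any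
   lattice point with [w y > 0] into the interior without changing [w y]. *)
Lemma facet_eval_ge1 w (y : 'rV[int]_N) : facet AQ nu w ->
  0 < (toQ y *m w) 0 0 -> 1 <= (toQ y *m w) 0 0.
Proof.
move=> [dw xw rw] wy.
have [a ha] : exists a, 0 < (AQ *m w) a 0.
  apply/existsP; apply: contraT => /existsPn h.
  have w0 : w = 0.
    apply: (row_full_ker0 fA); apply/matrixP => j k; rewrite ord1 [RHS]mxE.
    by apply/le_anti; rewrite dw andbT leNgt.
  by move/eqP: xw; rewrite w0 mulmx0 mxE eq_sym oner_eq0.
have wxi : 0 <= (xi *m w) 0 0 by rewrite xiE (dual_eval_ge0 mu_gt0).
pose d := (toQ y *m w) 0 0 / (1 + (xi *m w) 0 0).
have d0 : 0 < d by rewrite divr_gt0 // ltr_wpDr.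
pose z := toQ y - d *: xi.
have wz : 0 < (z *m w) 0 0.
  have -> : (z *m w) 0 0 = (toQ y *m w) 0 0 - d * (xi *m w) 0 0.
    rewrite mulmxBl -scalemxAl [LHS]mxE; congr (_ + _).
    by rewrite [LHS]mxE; congr (- _); rewrite [LHS]mxE.
  rewrite subr_gt0 /d mulrAC ltr_pdivrMr ?ltr_wpDr // ltr_pM2l //.
  by rewrite addrC ltrDl.
pose Z := zero_rows AQ w.
pose b := (z *m w) 0 0 / (AQ *m w) a 0.
have b0 : 0 < b by rewrite divr_gt0.
(* The choice of [b] puts this vector in the kernel of [w], which the zero rows span because both
   have rank [n]. *)
have : (z - b *: row a AQ <= Z)%MS.
  have kerZ : (Z <= kermx w)%MS by apply/sub_kermxP/zero_rows_mul.
  have w0 : w != 0 by apply: contraTneq wz => ->; rewrite mulmx0 mxE ltxx.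
  have rker : \rank (kermx w) = n.
    rewrite mxrank_ker (_ : \rank w = 1%N) ?subn1 //.
    apply/eqP; rewrite eqn_leq rank_leq_col lt0n.
    by apply: contra_neq w0 => /eqP; rewrite mxrank_eq0 => /eqP.
  have eqZ : (kermx w <= Z)%MS.
    by rewrite -(geq_leqif (mxrank_leqif_sup kerZ)) rker rw.
  apply: submx_trans eqZ; apply/sub_kermxP.
  rewrite mulmxBl -scalemxAl -row_mul; apply/matrixP => i j; rewrite !ord1.
  rewrite [LHS]mxE [X in _ + X]mxE [X in _ - X]mxE [X in _ * X]mxE /b.
  by rewrite divfK ?gt_eqF // subrr mxE.
move=> /submxP[c cE].
(* Adding [M] copies of every zero row makes all coefficients of this combination nonnegative. *)
pose M := Num.bound (\sum_j `|c 0 j|).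
have cM j : 0 <= c 0 j + M%:R.
  have h : `|c 0 j| <= \sum_j `|c 0 j|.
    by rewrite [X in _ <= X](bigD1 j) //= lerDl sumr_ge0.
  have h2 : \sum_j `|c 0 j| < M%:R.
    by apply: le_lt_trans (archi_boundP _); rewrite ?ler_norm ?sumr_ge0.
  have := ler_norm (- c 0 j); rewrite normrN => h3.
  by rewrite -lerBlDl sub0r; apply/(le_trans h3)/(le_trans h)/ltW.
pose f : 'rV[int]_N := \sum_(j | (AQ *m w) j 0 == 0) row j A.
have fE : toQ f = const_mx 1 *m Z.
  rewrite mulmx_sum_row (raddf_sum (map_mx intr)) big_mkcond.
  apply: eq_bigr => j _; rewrite [const_mx _ _ _]mxE scale1r rowK; case: ifP => // _.
  by apply/rowP => k; rewrite !mxE.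
have fw : toQ f *m w = 0 by rewrite fE -mulmxA zero_rows_mul mulmx0.
have fM : toQ (f *+ M) = M%:R *: toQ f by rewrite raddfMn scaler_nat.
have yw : (toQ (y + f *+ M) *m w) 0 0 = (toQ y *m w) 0 0.
  by rewrite map_mxD fM mulmxDl -scalemxAl fw scaler0 addr0.
have Iy : interior A xi (y + f *+ M).
  exists d => //; rewrite map_mxD addrAC -/z fM fE.
  rewrite -[z](subrK (b *: row a AQ)) cE addrAC scalemxAl -mulmxDl.
  apply: coneD; last by apply/coneZ/cone_row/ltW.
  rewrite mulmx_sum_row; elim/big_ind: _ => [|u v|j _]; [exact: cone0|exact: coneD|].
  rewrite rowK; case: ifP => _; last by rewrite scaler0; apply: cone0.
  by apply/coneZ/cone_row; rewrite mxE [X in _ + X]mxE [X in _ * X]mxE mulr1.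
have := cone_eval (int_sub Iy) dw.
rewrite map_mxB mulmxBl [X in 0 <= X]mxE [X in _ + X]mxE yw subr_ge0.
by rewrite xE xw.
Qed.

(** Subtracting from [y] the floor of its value times [x], where [w] is 1, leaves a lattice point
    whose value is the fractional part; if positive it would be at least 1. *)
Lemma facet_eval_int w (y : 'rV[int]_N) : facet AQ nu w ->
  (toQ y *m w) 0 0 = (Num.floor ((toQ y *m w) 0 0))%:~R.
Proof.
move=> fw; set c := (toQ y *m w) 0 0; set k := Num.floor c.
have := floor_itv c; rewrite -/k => /andP[k1 k2].
apply/eqP; rewrite eq_le k1 andbT leNgt; apply/negP => kc.
have [_ xw _] := fw.
have yk : (toQ (y - k *: x) *m w) 0 0 = c - k%:~R.
  rewrite map_mxB mulmxBl [LHS]mxE; congr (_ + _); rewrite [LHS]mxE; congr (- _).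
  have -> : toQ (k *: x) = k%:~R *: toQ x by apply/rowP => i; rewrite !mxE intrM.
  by rewrite -scalemxAl [LHS]mxE xE xw mulr1.
have := facet_eval_ge1 (y := y - k *: x) fw; rewrite yk subr_gt0 => /(_ kc).
by rewrite leNgt ltrBlDl -[1]/(1%:~R) -intrD k2.
Qed.

Lemma facet_integral w : facet AQ nu w -> w = toQ (map_mx Num.floor w).
Proof.
move=> fw; apply/matrixP => i j; rewrite ord1 !mxE.
have -> : w i 0 = (toQ (delta_mx 0 i : 'rV_N) *m w) 0 0.
  have -> : toQ (delta_mx 0 i : 'rV_N) = delta_mx 0 i.
    by apply/rowP => k; rewrite !mxE; case: (_ && _).
  by rewrite -rowE mxE.
exact: facet_eval_int.
Qed.

Lemma height_pos : forall j, 0 < (AQ *m toQ e) j 0.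
Proof. by move=> j; rewrite height1Q // mxE. Qed.

Definition zdual (u : 'cV[int]_N) := forall j, 0 <= (A *m u) j 0.

Lemma zdualP u : zdual u <-> dual AQ (toQ u).
Proof.
by split=> du j; have := du j; rewrite -map_mxM [in X in _ -> X]mxE ?mxE ler0z.
Qed.

(* The fractional part [g] of [e] in a basis of facets has [x]-value at most
   [d], since [sum_i w_i - g] is positive on the cone, hence dominates [e]. *)
Lemma height_decomposition d r : (r + d = N)%N -> height x = r%:Z ->
  exists us : seq 'cV[int]_N, [/\ forall u, u \in us -> u != 0,
    forall u, u \in us -> zdual u, \sum_(u <- us) u = e
    & (N - size us <= 2 * d - 1)%N].
Proof.
move=> rd xr.
have [W [l [fW uW l0 eW]]] := facet_basis nu_gt0 fA height_pos.
pose w i : 'cV[int]_N := map_mx Num.floor (row i W)^T.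
have wE i : toQ (w i) = (row i W)^T by rewrite -facet_integral.
have dw i : zdual (w i) by apply/zdualP; rewrite wE; have [] := fW i.
have xw i : (x *m w i) 0 0 = 1.
  apply: (intr_inj (R := rat)); have [_ + _] := fW i.
  by rewrite -wE -xE -map_mxM [X in X = _ -> _]mxE.
have w0 i : w i != 0.
  by apply/eqP => h; have /eqP := xw i; rewrite h mulmx0 mxE eq_sym oner_eq0.
pose k i := Num.truncn (l 0 i).
pose g := e - \sum_i w i *+ k i.
have lk i : 0 <= l 0 i - (k i)%:R < 1.
  by have /andP[h1 h2] := truncn_itv (l0 i); rewrite subr_ge0 h1 ltrBlDl natr1.
have gE : toQ g = \sum_i (l 0 i - (k i)%:R) *: (row i W)^T.
  rewrite map_mxB -[toQ e]trmxK eW mulmx_sum_row (raddf_sum trmx).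
  rewrite (raddf_sum (map_mx intr)) -sumrB; apply: eq_bigr => i _.
  by rewrite /= linearZ /= scalerBl raddfMn /= wE scaler_nat.
have dg : zdual g.
  apply/zdualP; rewrite gE => j; rewrite mulmx_sumr summxE sumr_ge0 // => i _.
  by have [/dualZ dwi _ _] := fW i; apply: dwi; case/andP: (lk i).
have xg : (x *m g) 0 0 = r%:Z - (\sum_i k i)%N%:Z.
  rewrite mulmxBr [LHS]mxE; congr (_ + _); first exact: xr.
  rewrite [LHS]mxE mulmx_sumr summxE -[in RHS]natz natr_sum; congr (- _).
  by apply: eq_bigr => i _; rewrite (raddfMn (mulmx x)) mulmxnE xw.
have xg0 : 0 <= (x *m g) 0 0.
  rewrite -(ler0z rat); have /zdualP/(dual_eval_ge0 nu_gt0) := dg.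
  by rewrite -xE -map_mxM [X in 0 <= X -> _]mxE.
have xgd : (x *m g) 0 0 <= d%:Z.
  pose g' := \sum_i w i - g.
  have dg' : zdual (g' - e).
    move=> j; rewrite mulmxBr height1 [X in 0 <= X]mxE [X in _ + X]mxE [X in _ - X]mxE.
    rewrite subr_ge0 -gtz0_ge1 -(ltr0z rat).
    have -> : ((A *m g') j 0)%:~R = (AQ *m toQ g') j 0 by rewrite -map_mxM [RHS]mxE.
    have -> : toQ g' = \sum_i (1 - (l 0 i - (k i)%:R)) *: (row i W)^T.
      rewrite map_mxB gE (raddf_sum (map_mx intr)) -sumrB; apply: eq_bigr => i _.
      by rewrite /= wE [in RHS]scalerBl scale1r.
    have F0 i : 0 <= (AQ *m ((1 - (l 0 i - (k i)%:R)) *: (row i W)^T)) j 0.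
      have [/dualZ dwi _ _] := fW i; apply: dwi.
      by rewrite subr_ge0 ltW //; case/andP: (lk i).
    rewrite mulmx_sumr summxE lt_def sumr_ge0 // andbT.
    apply/negP => /eqP/psumr_eq0P h.
    (* All coefficients [1 - (l_i - k_i)] are positive, so a zero sum makes every facet of the basis
       vanish on generator [j]; invertibility of [W] then makes it zero, against its height 1. *)
    have rj0 : row j AQ = 0.
      rewrite -[row j AQ]mulmx1 -[1%:M]trmx1 -(mulVmx uW) trmx_mul mulmxA.
      rewrite (_ : row j AQ *m W^T = 0) ?mul0mx //.
      apply/rowP => i; rewrite [RHS]mxE.
      have := h (fun i _ => F0 i) i isT.
      rewrite -scalemxAr [X in X = 0 -> _]mxE => /eqP; rewrite mulf_eq0.
      have /andP[_ lk1] := lk i; rewrite gt_eqF ?subr_gt0 //= => /eqP.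
      by rewrite -row_mul !mxE => {2}<-; apply: eq_bigr => z _; rewrite !mxE.
    have := height_pos j.
    have -> : (AQ *m toQ e) j 0 = (row j AQ *m toQ e) 0 0 by rewrite -row_mul [RHS]mxE.
    by rewrite rj0 mul0mx mxE ltxx.
  have := dual_eval_ge0 nu_gt0 ((zdualP _).1 dg').
  have -> : (nu *m AQ *m toQ (g' - e)) 0 0 = (N%:Z - (x *m g) 0 0 - r%:Z)%:~R.
    rewrite -xE -map_mxM [LHS]mxE; congr (_%:~R).
    rewrite /g' !mulmxBr [LHS]mxE; congr (_ + _); last by rewrite [LHS]mxE; congr (- _); exact: xr.
    rewrite [LHS]mxE; congr (_ + _); last by rewrite [LHS]mxE.
    rewrite mulmx_sumr summxE (eq_bigr (fun=> 1)) => [|i _]; last exact: xw.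
    by rewrite sumr_const card_ord natz.
  by rewrite ler0z; move: ((x *m g) 0 0) => ?; lia.
exists (flatten [seq nseq (k i) (w i) | i <- enum 'I_N] ++ (if g == 0 then [::] else [:: g])).
have memus u : u \in flatten [seq nseq (k i) (w i) | i <- enum 'I_N] ->
    exists i, u = w i.
  by move=> /flatten_mapP[i _]; rewrite mem_nseq => /andP[_ /eqP ->]; exists i.
have sizeus : size (flatten [seq nseq (k i) (w i) | i <- enum 'I_N]) = (\sum_i k i)%N.
  rewrite size_flatten /shape -map_comp sumnE big_map big_enum /=.
  by apply: eq_bigr => i _; rewrite size_nseq.
split.
- move=> u; rewrite mem_cat => /orP[/memus[i ->] //|].
  by case: ifP => [//|/negbT g0]; rewrite inE => /eqP ->.
- move=> u; rewrite mem_cat => /orP[/memus[i ->] //|].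
  by case: ifP => [//|_]; rewrite inE => /eqP ->.
- rewrite big_cat /= big_flatten /= big_map big_enum /=.
  rewrite (eq_bigr (fun i => w i *+ k i)) => [|i _]; last by rewrite big_nseq -Monoid.iteropE.
  have -> : \sum_(u <- if g == 0 then [::] else [:: g]) u = g.
    by case: eqP => [->|_]; rewrite ?big_nil ?big_seq1.
  by rewrite /g addrC subrK.
(* The multiplicities sum to [r - x g]. If [g = 0], the bound reads [d <= 2d - 1], true also for
   [d = 0] by truncation. Otherwise [1 <= x g <= d], and [g] itself supplies the one extra
   summand. *)
rewrite size_cat sizeus; have [g0|g0] := eqVneq g 0.
  have : (x *m g) 0 0 = 0 by rewrite g0 mulmx0 mxE.
  by rewrite xg /=; lia.
have : (x *m g) 0 0 != 0.
  apply: contra_neq g0 => h; apply: toQ_inj; rewrite map_mx0.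
  apply: (dual_eval0 nu_gt0 fA); first exact/zdualP.
  by rewrite -xE -map_mxM [LHS]mxE h.
by move: xgd xg0; rewrite xg /=; lia.
Qed.

End HeightDecomposition.

(** * Unimodular completion, hulls and change of field *)

(** In the Smith form of [U] the last [q] rows of [invmx L] annihilate [U]. The last [q] columns of
    [L], projected along [U] onto the kernel of [D], give the complement [V]. *)
Lemma unimodular_completion n q s (U : 'M[int]_(n, s)) (D : 'M[int]_(s, n)) :
  n = (q + s)%N -> D *m U = 1%:M ->
  exists (V : 'M[int]_(n, q)) (B : 'M[int]_(q + s, n)),
    row_mx V U *m B = 1%:M /\ B *m row_mx V U = 1%:M.
Proof.
move=> nE; subst n => DU; have [L uL [R uR [d _ UE]]] := int_Smith_normal_form U.
pose f i : 'I_(q + s) := cast_ord (addnC s q) (rshift s i).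
have f_inj : injective f by move=> i j /cast_ord_inj/rshift_inj.
pose G := rowsub f (invmx L); pose V := (1%:M - U *m D) *m colsub f L.
have GU : G *m U = 0.
  rewrite /G mul_rowsub_mx UE -mulmxA mulKmx // -mul_rowsub_mx.
  rewrite (_ : rowsub f _ = 0) ?mul0mx //; apply/matrixP => i j; rewrite !mxE.
  rewrite (_ : (_ == _) = false) //; apply/eqP => /eqP; rewrite /= => /eqP ij.
  by have := ltn_ord j; rewrite -ij; lia.
have GV : G *m V = 1%:M.
  rewrite /V mulmxA mulmxBr mulmx1 mulmxA GU mul0mx subr0.
  rewrite mul_rowsub_mx mulmx_colsub mulVmx //.
  by apply/matrixP => i j; rewrite !mxE (inj_eq f_inj).
have DV : D *m V = 0 by rewrite /V mulmxA mulmxBr mulmx1 mulmxA DU mul1mx subrr mul0mx.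
exists V, (col_mx G D).
have BV : col_mx G D *m row_mx V U = 1%:M.
  by rewrite mul_col_row GV GU DV DU -scalar_mx_block.
by rewrite (mulmx1C BV).
Qed.

Section Hull.
Variables (R : realFieldType).

Definition mxhull {K k} (M : 'M[R]_(K, k)) (y : 'rV[R]_k) :=
  exists l : 'rV[R]_K, [/\ nneg l, \sum_j l 0 j = 1 & y = l *m M].

Lemma mxhull_row K k (M : 'M[R]_(K, k)) j : mxhull M (row j M).
Proof.
exists (delta_mx 0 j); split; last by rewrite -rowE.
  by move=> i; rewrite mxE ler0n.
rewrite (bigD1 j) //= mxE !eqxx big1 ?addr0 // => i ij.
by rewrite mxE (negPf ij) andbF.
Qed.

Lemma mxhull_convex K k (M : 'M[R]_(K, k)) m (p : 'I_m -> 'rV[R]_k) (w : 'I_m -> R) :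
  (forall i, mxhull M (p i)) -> (forall i, 0 <= w i) -> \sum_i w i = 1 ->
  mxhull M (\sum_i w i *: p i).
Proof.
move=> /fin_all_exists[l Hl] w0 w1; exists (\sum_i w i *: l i); split.
- move=> j; rewrite summxE sumr_ge0 // => i _; rewrite mxE mulr_ge0 //.
  by have [] := Hl i.
- under eq_bigr do rewrite summxE; rewrite exchange_big /= -w1.
  apply: eq_bigr => i _; have [_ l1 _] := Hl i.
  by under eq_bigr do rewrite mxE; rewrite -mulr_sumr l1 mulr1.
rewrite mulmx_suml; apply: eq_bigr => i _.
by have [_ _ ->] := Hl i; rewrite scalemxAl.
Qed.

Lemma in_hull_mxhull K k (M : 'M[R]_(K, k)) (S : 'rV[R]_k -> Prop) y :
  (forall x, S x -> mxhull M x) -> in_hull S y -> mxhull M y.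
Proof.
by move=> SM [m [p [w [Sp w0 w1 ->]]]]; apply: mxhull_convex => // i; apply: SM.
Qed.

Lemma mxhull_in_hull K k (M : 'M[R]_(K, k)) (S : 'rV[R]_k -> Prop) y :
  (forall j, S (row j M)) -> mxhull M y -> in_hull S y.
Proof.
move=> SM [l [l0 l1 ->]]; exists K, (fun j => row j M), (fun j => l 0 j).
by split=> //; rewrite mulmx_sum_row.
Qed.

Lemma in_hull_sub k (S : 'rV[R]_k -> Prop) y : S y -> in_hull S y.
Proof.
move=> Sy; exists 1%N, (fun=> y), (fun=> 1).
by split=> //; rewrite big_ord1 ?scale1r.
Qed.

Definition vertex_mx {k} (V : seq 'rV[int]_k) : 'M[int]_(size V, k) :=
  \matrix_i V`_i.

Lemma conv_latP k (V : seq 'rV[int]_k) y :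
  conv_lat V y <-> mxhull (map_mx intr (vertex_mx V)) y.
Proof.
have rowV (i : 'I_(size V)) : row i (map_mx intr (vertex_mx V)) = intvec R V`_i.
  by rewrite -map_row rowK.
split; [apply: in_hull_mxhull => x [v vV ->]|apply: mxhull_in_hull => i].
  have iV : (index v V < size V)%N by rewrite index_mem.
  by rewrite -(nth_index 0 vV) -(rowV (Ordinal iV)); apply: mxhull_row.
by rewrite rowV; exists V`_i; rewrite ?mem_nth.
Qed.

End Hull.

Section Transfer.
Variables (R : realFieldType) (K N : nat) (A : 'M[int]_(K, N)).

Lemma map_ratr_int m k (M : 'M[int]_(m, k)) :
  map_mx (ratr : rat -> R) (toQ M) = map_mx intr M.
Proof. by apply/matrixP => i j; rewrite !mxE ratr_int. Qed.

Lemma row_full_transfer : row_full (map_mx intr A : 'M[R]_(K, N)) = row_full (toQ A).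
Proof. by rewrite -map_ratr_int row_full_map. Qed.

(** By Caratheodory's theorem, membership over either field amounts to nonnegative coordinates in
    some basis, and those coordinates are rational. *)
Lemma cone_transfer (y : 'rV[int]_N) : row_full (toQ A) ->
  cone (map_mx intr A : 'M[R]_(K, N)) (map_mx intr y) <-> cone (toQ A) (toQ y).
Proof.
move=> fA; have fAR : row_full (map_mx intr A : 'M[R]_(K, N)).
  by rewrite row_full_transfer.
have basisE s : basis (map_mx intr A : 'M[R]_(K, N)) s = basis (toQ A) s.
  by rewrite /basis -map_ratr_int -map_mxsub map_unitmx.
have coordE s : coord (map_mx intr A : 'M[R]_(K, N)) s (map_mx intr y)
    = map_mx ratr (coord (toQ A) s (toQ y)).
  by rewrite /coord map_mxM map_invmx map_mxsub !map_ratr_int.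
have coord_sign s : nneg (coord (map_mx intr A : 'M[R]_(K, N)) s (map_mx intr y))
    <-> nneg (coord (toQ A) s (toQ y)).
  have e i : (0 <= (map_mx (ratr : rat -> R) (coord (toQ A) s (toQ y))) 0 i)
      = (0 <= coord (toQ A) s (toQ y) 0 i).
    by rewrite [X in (0 <= X) = _]mxE ler0q.
  by rewrite coordE; split=> H i; have := H i; rewrite e.
split=> [/(caratheodory fAR)|/(caratheodory fA)] [s bs /coord_sign cs].
  by apply: coord_cone cs; rewrite -basisE.
by apply: coord_cone cs; rewrite basisE.
Qed.

End Transfer.

(** * Cayley decompositions *)

Lemma sum_nat_eq1 (I : finType) (f : I -> int) : (forall i, 0 <= f i) ->
  \sum_i f i = 1 -> exists2 i, f i = 1 & forall j, j != i -> f j = 0.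
Proof.
move=> f0 f1; have [i fi] : exists i, 0 < f i.
  apply/existsP; apply: contraT => /existsPn h.
  have : \sum_i f i <= 0 by apply: sumr_le0 => i _; rewrite leNgt.
  by rewrite f1.
have := f1; rewrite (bigD1 i) //=.
have S0 : 0 <= \sum_(j | j != i) f j by apply: sumr_ge0.
move=> e1; have [fi1 Se] : f i = 1 /\ \sum_(j | j != i) f j = 0.
  by move: (\sum_(j | j != i) f j) S0 e1 => S; lia.
by exists i => // j ji; apply: (psumr_eq0P (P := fun j => j != i) _ Se).
Qed.

Definition homogenize {K n} (M : 'M[int]_(K, n)) : 'M[int]_(K, n.+1) :=
  row_mx (const_mx 1 : 'M_(K, 1)) M.

Definition first_coord n : 'cV[int]_n.+1 := col_mx (1%:M : 'M_1) (0 : 'M_(n, 1)).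

Lemma homogenize_height K n (M : 'M[int]_(K, n)) :
  homogenize M *m first_coord n = const_mx 1.
Proof. by rewrite /homogenize /first_coord -[n.+1]/(1 + n)%N mul_row_col mulmx1 mulmx0 addr0. Qed.

Section Cayley.
Variables (R : realFieldType) (n : nat) (V : seq 'rV[int]_n).
Local Notation VM := (vertex_mx V).
Local Notation A := (homogenize VM).

(** At each vertex the nonnegative integers [v j i] sum to 1, so the functionals sort the vertices
    into [s + 1] groups. The linear parts of all functionals but the first become the last [s]
    coordinates, where the groups sit over 0 and the standard basis. *)
Lemma cayley_of_functionals s (P : 'rV[R]_n -> Prop) (u : 'I_s.+1 -> 'cV[int]_n.+1) :
  (forall x, P x <-> conv_lat V x) -> row_full (toQ A) ->
  (forall j, u j != 0) -> (forall j, zdual A (u j)) ->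
  \sum_j u j = first_coord n -> cayley_decomposes P (n - s).
Proof.
move=> PV fA u0 du su.
pose v j i := (A *m u j) i 0.
have v_sum i : \sum_j v j i = 1.
  by rewrite /v -summxE -mulmx_sumr su homogenize_height mxE.
have v_one i := sum_nat_eq1 (fun j => du j i) (v_sum i).
(* No group is empty: a functional vanishing at all vertices would be zero. *)
have /fin_all_exists[a Ha] : forall j, exists i, v j i = 1.
  move=> j; have [i vi] : exists i, v j i != 0.
    apply/existsP; apply: contraT => /existsPn h.
    have : toQ (u j) = 0.
      apply: (row_full_ker0 fA); rewrite -map_mxM.
      apply/matrixP => i k; have /negPn/eqP vi := h i.
      by rewrite ord1 [LHS]mxE [RHS]mxE [_ i 0]vi.
    rewrite -[0](map_mx0 (intr : {rmorphism int -> rat})) => /toQ_inj uj.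
    by have := u0 j; rewrite uj eqxx.
  have [j' vj' h] := v_one i; exists i.
  case: (eqVneq j j') => [-> //|/h e]; by move: vi; rewrite /v e eqxx.
have v0 j j' i : v j i = 1 -> j' != j -> v j' i = 0.
  move=> vj; have [j1 vj1 h] := v_one i.
  case: (eqVneq j j1) => [-> /h //|/h e].
  by move/eqP: vj; rewrite /v e eq_sym oner_eq0.
pose U : 'M[int]_(n, s) := \matrix_(i, k) dsubmx (u (lift ord0 k) : 'M_(1 + n, 1)) i 0.
pose c : 'rV[int]_s := \row_k usubmx (u (lift ord0 k) : 'M_(1 + n, 1)) 0 0.
have vE i k : v (lift ord0 k) i = (VM *m U) i k + c 0 k.
  rewrite /v.
  have -> : A *m u (lift ord0 k) = (const_mx 1 : 'M_(size V, 1))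
      *m usubmx (u (lift ord0 k) : 'M_(1 + n, 1))
      + VM *m dsubmx (u (lift ord0 k) : 'M_(1 + n, 1)).
    by rewrite -mul_row_col vsubmxK.
  rewrite mxE addrC; congr (_ + _).
    by rewrite [LHS]mxE [RHS]mxE; apply: eq_bigr => z _; rewrite [U z k]mxE.
  by rewrite [LHS]mxE big_ord1 [const_mx _ _ _]mxE mul1r [RHS]mxE.
(* Differences of one vertex from each group give an integral left inverse of [U]; this makes the
   completion possible and forces [s <= n]. *)
pose D : 'M[int]_(s, n) := \matrix_k (row (a (lift ord0 k)) VM - row (a ord0) VM).
have DU : D *m U = 1%:M.
  apply/row_matrixP => k; rewrite row_mul rowK row1 mulmxBl -!row_mul.
  apply/rowP => k'; rewrite [LHS]mxE [X in _ + X]mxE ![row _ _ 0 k']mxE [RHS]mxE.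
  have -> : (VM *m U) (a (lift ord0 k)) k' - (VM *m U) (a ord0) k'
     = v (lift ord0 k') (a (lift ord0 k)) - v (lift ord0 k') (a ord0).
    by rewrite !vE opprD addrACA subrr addr0.
  rewrite (v0 _ _ _ (Ha ord0)) ?subr0 //.
  case: (eqVneq k' k) => [->|kk]; first by rewrite Ha.
  by rewrite (v0 _ _ _ (Ha (lift ord0 k))) // ?(inj_eq lift_inj) // andbF.
have tail_row i j : v j i = 1 -> row i VM *m U + c = \row_k (j == lift ord0 k)%:R.
  move=> vj; apply/rowP => k; rewrite -row_mul [LHS]mxE [row _ _ 0 k]mxE -vE [RHS]mxE.
  case: (eqVneq j (lift ord0 k)) => [<- //|jk].
  by rewrite (v0 _ _ _ vj) // eq_sym.
have nE : n = (n - s + s)%N by rewrite subnK // (mulmx1_min DU).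
set q := (n - s)%N in nE *.
have [Vc [B [AB BA]]] := unimodular_completion nE DU.
pose AA := row_mx Vc U; pose b : 'rV[int]_(q + s) := row_mx 0 c.
pose tail j : 'rV[int]_s := \row_k (j == lift ord0 k)%:R.
have affE i j : v j i = 1 -> row i VM *m AA + b = row_mx (row i (VM *m Vc)) (tail j).
  by move=> vj; rewrite mul_mx_row add_row_mx addr0 (tail_row _ _ vj) row_mul.
pose W j : seq 'rV[int]_q := [seq row i (VM *m Vc) | i <- enum 'I_(size V) & v j i == 1].
have W0 j : W j != [::].
  have : row (a j) (VM *m Vc) \in W j.
    by apply/mapP; exists (a j); rewrite // mem_filter mem_enum Ha eqxx.
  by case: (W j).
pose toR k l (M : 'M[int]_(k, l)) : 'M[R]_(k, l) := map_mx intr M.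
pose fR (x : 'rV[R]_n) := x *m toR _ _ AA + toR _ _ b.
pose FR := \matrix_i fR (row i (toR _ _ VM)).
have rowF i j : v j i = 1 ->
    row i FR = row_mx (intvec R (row i (VM *m Vc))) (intvec R (tail j)).
  move=> vj; rewrite rowK /fR -map_row /toR -map_mxM -map_mxD (affE _ _ vj).
  by rewrite map_row_mx.
have FRE (l : 'rV[R]_(size V)) : \sum_i l 0 i = 1 -> fR (l *m toR _ _ VM) = l *m FR.
  move=> l1; rewrite [RHS]mulmx_sum_row.
  under eq_bigr do rewrite rowK scalerDr.
  rewrite big_split /= -scaler_suml l1 scale1r; congr (_ + _).
  rewrite [X in X *m _]mulmx_sum_row mulmx_suml.
  by apply: eq_bigr => i _; rewrite scalemxAl.
have hull_piece j x : conv_lat (W j) x -> mxhull FR (row_mx x (intvec R (tail j))).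
  move=> [m [p [w [Wp w0 w1 ->]]]].
  have -> : row_mx (\sum_i w i *: p i) (intvec R (tail j))
      = \sum_i w i *: row_mx (p i) (intvec R (tail j)).
    under [RHS]eq_bigr do rewrite scale_row_mx.
    apply/rowP => z; rewrite -[z]splitK; case: (split z) => z' /=.
      rewrite row_mxEl !summxE; apply: eq_bigr => i _.
      by rewrite [RHS]row_mxEl.
    rewrite row_mxEr summxE; under eq_bigr do rewrite row_mxEr mxE.
    by rewrite -mulr_suml w1 mul1r.
  apply: mxhull_convex => // i; have [r /mapP[z + ->] ->] := Wp i.
  by rewrite mem_filter => /andP[/eqP vz _]; rewrite -(rowF _ _ vz); apply: mxhull_row.
have tail0 : intvec R (tail ord0) = 0.
  by apply/rowP => k; rewrite !mxE.
have tailS k : intvec R (tail (lift ord0 k)) = delta_mx 0 k.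
  apply/rowP => z; rewrite !mxE (inj_eq lift_inj) eq_sym.
  by case: (z == k).
have row_piece i j : v j i = 1 -> conv_lat (W j) (intvec R (row i (VM *m Vc))).
  move=> vj; apply: in_hull_sub; exists (row i (VM *m Vc)) => //.
  by apply/mapP; exists i; rewrite // mem_filter mem_enum vj eqxx.
exists s, (toR _ _ AA), (toR _ _ B), (toR _ _ b), (conv_lat (W ord0)),
  (fun k => conv_lat (W (lift ord0 k))); split.
- by rewrite /toR -!map_mxM AB BA !map_mx1.
- by move=> x [z ->]; exists (z *m AA + b); rewrite /intvec map_mxD map_mxM.
- move=> y [z ->]; exists (intvec R ((z - b) *m B)); first by exists ((z - b) *m B).
  by rewrite /intvec /toR -map_mxM -mulmxA BA mulmx1 -map_mxD subrK.
- by split=> [|k]; [exists (W ord0) | exists (W (lift ord0 k))].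
move=> y; split=> [[x /PV/conv_latP[l [l0 l1 ->]] <-]|].
  rewrite -/(fR _) FRE //; apply: (mxhull_in_hull (M := FR)); last by exists l.
  move=> i; have [j vj _] := v_one i; rewrite (rowF _ _ vj).
  case: (unliftP ord0 j) vj => [k ->|->] vj.
    right; exists k, (intvec R (row i (VM *m Vc))); first exact: row_piece.
    by rewrite tailS.
  left; exists (intvec R (row i (VM *m Vc))); first exact: row_piece.
  by rewrite tail0.
move=> /(@in_hull_mxhull _ _ _ FR)[].
  move=> z [[x Wx ->]|[k [x Wx ->]]].
    by rewrite -tail0; apply: hull_piece.
  by rewrite -tailS; apply: hull_piece.
move=> l [l0 l1 ->]; exists (l *m toR _ _ VM); last by rewrite -/(fR _) FRE.
by apply/PV/conv_latP; exists l.
Qed.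

End Cayley.

(** * Homogenization *)

Definition at_height {n} (m : nat) (z : 'rV[int]_n) : 'rV[int]_n.+1 :=
  row_mx (const_mx m%:Z : 'rV_1) z.

Section Homogenize.
Variables (R : realFieldType) (n : nat) (V : seq 'rV[int]_n).
Hypothesis V0 : V != [::].
Local Notation VM := (vertex_mx V).
Local Notation A := (homogenize VM).

Lemma map_homogenize : map_mx intr A =
  row_mx (const_mx 1 : 'cV[R]_(size V)) (map_mx intr VM).
Proof.
rewrite /homogenize -[n.+1]/(1 + n)%N map_row_mx; congr row_mx.
by apply/matrixP => i j; rewrite !mxE.
Qed.

Lemma cone_at_height m (z : 'rV[int]_n) :
  cone (map_mx intr A : 'M[R]_(_, _)) (map_mx intr (at_height m z)) <->
  exists2 x, conv_lat V x & intvec R z = m%:R *: x.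
Proof.
have zE : map_mx intr (at_height m z) = row_mx (const_mx m%:R : 'rV[R]_1) (intvec R z).
  rewrite /at_height -[n.+1]/(1 + n)%N map_row_mx; congr row_mx.
  by apply/matrixP => i j; rewrite !mxE.
have sumE (l : 'rV[R]_(size V)) : l *m (const_mx 1 : 'cV_(size V)) = const_mx (\sum_j l 0 j).
  apply/matrixP => i j; rewrite !ord1 mxE [RHS]mxE.
  by apply: eq_bigr => k _; rewrite [const_mx _ _ _]mxE mulr1.
split=> [[l l0]|[x /conv_latP[l [l0 l1 xE]] zx]].
  rewrite map_homogenize zE -[n.+1]/(1 + n)%N mul_mx_row sumE => /eq_row_mx[/matrixP/(_ 0 0)].
  rewrite mxE [RHS]mxE => sl zl; rewrite zl.
  (* At height 0 no rescaling is possible, but the coefficients all vanish and any vertex serves as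
     witness; here [V] must be nonempty. *)
  case: m {zE} sl => [|m] sl.
    have lz : l = 0.
      have s0 : \sum_j l 0 j = 0 by rewrite -sl.
      by apply/rowP => j; rewrite [RHS]mxE (psumr_eq0P (fun i _ => l0 i) s0).
    have sV : (0 < size V)%N by case: (V) V0.
    exists (row (Ordinal sV) (map_mx intr VM)); first exact/conv_latP/mxhull_row.
    by rewrite lz mul0mx scale0r.
  exists ((m.+1%:R^-1 *: l) *m map_mx intr VM); last first.
    by rewrite -scalemxAl scalerA divff ?scale1r // pnatr_eq0.
  apply/conv_latP; exists (m.+1%:R^-1 *: l); split=> //.
    by move=> j; rewrite mxE mulr_ge0 // invr_ge0 ler0n.
  under eq_bigr do rewrite mxE; rewrite -mulr_sumr -sl mulVf //.
  by rewrite pnatr_eq0.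
exists (m%:R *: l); first by move=> j; rewrite mxE mulr_ge0 // ler0n.
rewrite map_homogenize zE zx xE -[n.+1]/(1 + n)%N -scalemxAl mul_mx_row scale_row_mx sumE l1; congr row_mx.
by apply/matrixP => i j; rewrite !mxE mulr1.
Qed.

(** A kernel vector is an affine function vanishing on [P]; the [n] independent differences kill its
    linear part, then its constant. *)
Lemma row_full_homogenize (P : 'rV[R]_n -> Prop) :
  (forall x, P x <-> conv_lat V x) -> full_dim P -> row_full (toQ A).
Proof.
move=> PV [p [Pp rp]]; rewrite -(row_full_transfer R).
rewrite /row_full -mxrank_tr -/(row_free _) -kermx_eq0.
apply/eqP/row_matrixP => i; rewrite row0.
have : row i (kermx (map_mx intr A : 'M[R]_(_, _))^T) *m (map_mx intr A)^T = 0.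
  by rewrite -row_mul mulmx_ker row0.
move: (row i _) => v vA; apply: trmx_inj; rewrite trmx0.
have {vA} : map_mx intr A *m v^T = 0.
  by apply: trmx_inj; rewrite trmx_mul trmxK vA trmx0.
rewrite -[v^T](@vsubmxK _ 1 n) map_homogenize -[n.+1]/(1 + n)%N mul_row_col.
set c := usubmx _; set w := dsubmx _ => cw.
have pw x : P x -> c + x *m w = 0.
  move=> /PV/conv_latP[l [_ l1 ->]]; have := congr1 (mulmx l) cw.
  rewrite mulmx0 mulmxDr !mulmxA => <-; congr (_ + _).
  rewrite (_ : l *m _ = 1%:M) ?mul1mx //; apply/matrixP => a b.
  rewrite !ord1; transitivity (\sum_k l 0 k); last by rewrite l1 mxE eqxx.
  by rewrite mxE; apply: eq_bigr => k _; rewrite [const_mx _ _ _]mxE mulr1.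
have w0 : w = 0.
  apply: (row_full_ker0 (introT eqP rp)).
  apply/row_matrixP => k; rewrite row_mul rowK row0 mulmxBl.
  have e0 := pw _ (Pp ord0); have := pw _ (Pp (lift ord0 k)).
  by rewrite -[in RHS]e0 => /addrI ->; rewrite subrr.
have c0 : c = 0 by have := pw _ (Pp ord0); rewrite w0 mulmx0 addr0.
by rewrite c0 w0 col_mx0.
Qed.

End Homogenize.

(** The lists exist separately for each [m]. A function [L] is extracted by [xchoose], which needs
    decidable conditions; hence cone membership is tested through bases. *)
Lemma lattice_points_hstar (R : realFieldType) n (V : seq 'rV[int]_n)
  (P : 'rV[R]_n -> Prop) h : V != [::] -> (forall x, P x <-> conv_lat V x) ->
  row_full (toQ (homogenize (vertex_mx V))) -> is_hstar P h ->
  exists L : nat -> seq 'rV[int]_n.+1, [/\ forall m, uniq (L m),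
    forall m y, y \in L m <-> cone (toQ (homogenize (vertex_mx V))) (toQ y) /\
                              height (first_coord n) y = m%:Z
    & forall m, (size (L m))%:Z =
        \sum_(i < size h | (i <= m)%N) h`_i * ('C(m - i + n, n))%:Z].
Proof.
move=> V0 PV fA hP; set A := homogenize _ in fA *.
pose inC m y := [exists s, basis (toQ A) s && [forall i, 0 <= coord (toQ A) s (toQ y) 0 i]]
  && (height (first_coord n) y == m%:Z).
have inCP m y : inC m y <-> cone (toQ A) (toQ y) /\ height (first_coord n) y = m%:Z.
  split=> [/andP[/existsP[s /andP[bs /forallP cs]] /eqP]|[/(caratheodory fA)[s bs cs] hy]].
    by split=> //; apply: coord_cone bs cs.
  rewrite /inC hy eqxx andbT; apply/existsP; exists s; rewrite bs.
  exact/forallP.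
pose count m := \sum_(i < size h | (i <= m)%N) h`_i * ('C(m - i + n, n))%:Z.
pose good m (s : seq 'rV[int]_n.+1) :=
  [&& uniq s, all (inC m) s & (size s)%:Z == count m].
have atE m y : height (first_coord n) y = m%:Z -> exists z, y = at_height m z.
  move=> hy; exists (@rsubmx _ 1 1 n y).
  have e : @lsubmx _ 1 1 n y = const_mx m%:Z.
    move: hy; rewrite /height -[y in y *m _](@hsubmxK _ 1 1 n).
    rewrite (mul_row_col _ _ (1%:M : 'M_1)) mulmx1 mulmx0 addr0 => hy.
    by apply/matrixP => i j; rewrite !ord1 hy mxE.
  by rewrite /at_height -e hsubmxK.
have heightE m z : height (first_coord n) (@at_height n m z) = m%:Z.
  rewrite /height /at_height /first_coord -[n.+1]/(1 + n)%N.
  by rewrite mul_row_col mulmx1 mulmx0 addr0 mxE.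
have at_inj m : injective (@at_height n m).
  by move=> z z' /(@eq_row_mx _ 1 1 n)[].
have full m : exists s, good m s /\ forall y, inC m y -> y \in s.
  have [c [[s [us <- sP]] cE]] := hP m.
  have mem z : z \in s <-> inC m (at_height m z).
    rewrite inCP -(cone_transfer R) // heightE; split=> [/sP|].
      move=> [x /PV xP zx]; split=> //; apply/cone_at_height => //.
      by exists x.
    move=> [/(cone_at_height R V0)[x xP zx] _]; apply/sP.
    by exists x => //; apply/PV.
  exists [seq at_height m z | z <- s]; split.
    rewrite /good map_inj_uniq // us size_map cE eqxx andbT /=.
    by apply/allP => y /mapP[z /mem ? ->].
  move=> y iy; have [_ /atE[z yz]] := (inCP m y).1 iy.
  by rewrite yz; apply: map_f; apply/mem; rewrite -yz.
have ex m : exists s, good m s by have [s [gs _]] := full m; exists s.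
exists (fun m => xchoose (ex m)).
split=> [m|m y|m]; have /and3P[us /allP ins /eqP szs] := xchooseP (ex m) => //.
rewrite -inCP; split=> [/ins //|iy].
have [s [/and3P[us' /allP ins' /eqP szs'] alls]] := full m.
have sub : {subset xchoose (ex m) <= s} by move=> z /ins; apply: alls.
(* The chosen list is duplicate-free, contained in a complete list and of the same size, hence
   complete. *)
have [|_ ->] := uniq_min_size us sub; last exact: alls.
by rewrite -lez_nat szs szs'.
Qed.

Theorem theorem3p1 (R : realFieldType) (n : nat) (P : 'rV[R]_n -> Prop)
  (h : {poly int}) :
  lattice_polytope P -> full_dim P -> is_hstar P h -> gorenstein_hstar h ->
  exists2 q : nat, (q <= 2 * hdeg h - 1)%N & cayley_decomposes P q.
Proof.
move=> [V [V0 PV]] Pdim hP symh.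
have fA := row_full_homogenize PV Pdim; set A := homogenize _ in fA.
have height1 : A *m first_coord n = const_mx 1 := homogenize_height _.
have [L [uniqL memL sizeL]] := lattice_points_hstar V0 PV fA hP.
have [x [xi [r [rd xr [mu mu0 xiE] [d d0 [l l0 xl]] xC]]]] :=
  gorenstein_point height1 fA uniqL memL sizeL symh.
(* Interiority of [x] supplies strictly positive coefficients, so it can normalise the facets. *)
have xE : toQ x = (l + d *: mu) *m toQ A.
  by rewrite mulmxDl -xl -scalemxAl -xiE subrK.
have nu0 j : 0 < (l + d *: mu) 0 j.
  rewrite mxE; apply: ltr_wpDl; first exact: l0.
  by rewrite mxE mulr_gt0.
have [us [us0 us_dual us_sum us_size]] :=
  height_decomposition height1 fA mu0 xiE nu0 xE xC rd xr.
case: us us0 us_dual us_sum us_size => [_ _|u us us0 us_dual us_sum us_size].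
  rewrite big_nil => e0; have := height1; rewrite -e0 mulmx0.
  have sV : (0 < size V)%N by case: (V) V0.
  by move=> /matrixP/(_ (Ordinal sV) 0); rewrite !mxE => /eqP; rewrite eq_sym oner_eq0.
pose f (j : 'I_(size us).+1) := (u :: us)`_j.
have f_mem j : f j \in u :: us by apply: mem_nth.
have f_sum : \sum_j f j = first_coord n.
  by rewrite -us_sum [RHS](big_nth 0) big_mkord.
(* Here [us] is the tail of the list: [s + 1] functionals give [q = n - s = (n + 1) - (s + 1)]. *)
exists (n - size us)%N; first by move: us_size => /=; rewrite subSS.
apply: (cayley_of_functionals (u := f) PV fA) => // j; first exact: us0.
exact: us_dual.
Qed.
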